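(* Let $\mu$ be a freely infinitely divisible (FID) probability measure on $\mathbb{R}$ with free characteristic triplet $(\eta_\mu,a_\mu,\nu_\mu)$. (1) If either $a_\mu>0$, or $a_\mu=0$ and $\nu_\mu(\mathbb{R})\in(1,\infty]$, then $\mu$ is absolutely continuous with respect to the Lebesgue measure with a continuous density function on $\mathbb{R}$. (2) If $a_\mu=0$ and $\nu_\mu(\mathbb{R})=1$, then $\mu$ is absolutely continuous with respect to the Lebesgue measure. (3) If $a_\mu=0$ and $\nu_\mu(\mathbb{R})\in[0,1)$, then the limit $F_\mu^{-1}(+i0)\in\mathbb{R}$ exists and $\mu(\{F_\mu^{-1}(+i0)\})=1-\nu_\mu(\mathbb{R})$.
   Context: Free convolution: for a probability measure $\mu$ on $\mathbb{R}$ let $G_\mu(z)=\int_{\mathbb{R}}\frac{1}{z-x}\,\mu(dx)$ and $F_\mu(z)=1/G_\mu(z)$ for $z\in\mathbb{C}^+$. The right compositional inverse $F_\mu^{-1}$ exists on a truncated cone $\{z\in\mathbb{C}^+ : \operatorname{Im}(z)>M,\ |\operatorname{Re}(z)|<\lambda\operatorname{Im}(z)\}$. The free cumulant transform is $\mathcal{C}_\mu(z)=zF_\mu^{-1}(1/z)-1$ (for $1/z$ in the cone). The free convolution $\boxplus$ is characterized by $\mathcal{C}_{\mu\boxplus\rho}=\mathcal{C}_\mu+\mathcal{C}_\rho$ on the common domain. FID measures: $\mu$ is freely infinitely divisible (FID) if for every $n\in\mathbb{N}$ there is a probability measure $\mu_n$ with $\mu_n^{\boxplus n}=\mu$. Equivalently,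 $\mathcal{C}_\mu$ extends to $\mathbb{C}^-$ with the free L\'evy--Khintchine representation $$\mathcal{C}_\mu(z)=\eta_\mu z+a_\mu z^2+\int_{\mathbb{R}}\Big(\frac{1}{1-tz}-1-tz1_{[-1,1]}(t)\Big)\nu_\mu(dt),\qquad z\in\mathbb{C}^-,$$ where $\eta_\mu\in\mathbb{R}$, $a_\mu\ge0$ and $\nu_\mu$ is a nonnegative measure on $\mathbb{R}$ with $\nu_\mu(\{0\})=0$ and $\int_{\mathbb{R}}\min\{1,t^2\}\,\nu_\mu(dt)<\infty$. The triplet $(\eta_\mu,a_\mu,\nu_\mu)$ is unique and called the free characteristic triplet. For FID $\mu$, $F_\mu^{-1}$ denotes the analytic extension to $\mathbb{C}^+$ given by $F_\mu^{-1}(z)=z+z\,\mathcal{C}_\mu(1/z)$, and $F_\mu^{-1}(+i0):=\lim_{y\downarrow0}F_\mu^{-1}(iy)$. *)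

(* Defs.v *)
From HB Require Import structures.
From mathcomp Require Import all_boot all_order all_algebra.
From mathcomp Require Import complex.
From mathcomp Require Import all_classical all_reals all_analysis.

Set Implicit Arguments.
Unset Strict Implicit.
Unset Printing Implicit Defensive.

Import Order.TTheory GRing.Theory Num.Theory.
Import numFieldNormedType.Exports.

Local Open Scope classical_set_scope.
Local Open Scope ring_scope.
Local Open Scope complex_scope.

(** Measures on the real line are measures on [measurableTypeR R], the real
    line with its Borel sigma-algebra. *)
Notation probR R := (probability (measurableTypeR R) R).
Notation measR R := {measure set (measurableTypeR R) -> \bar R}.

Section Defs.
Variable R : realType.

Definition cintegral (m : measR R) (f : R -> R[i]) : R[i] :=
  Rintegral m setT (fun x => complex.Re (f x))
    +i* Rintegral m setT (fun x => complex.Im (f x)).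

Definition cauchy_transform (mu : probR R) (z : R[i]) : R[i] :=
  cintegral mu (fun x => (z - x%:C)^-1).

Definition recip_cauchy (mu : probR R) (z : R[i]) : R[i] :=
  (cauchy_transform mu z)^-1.

Definition trunc_cone (lambda M : R) : set R[i] :=
  [set z | M < complex.Im z /\
           `|complex.Re z| < lambda * complex.Im z].

(** [F_mu] may have several right inverses on a cone: for the symmetric
    Bernoulli law [F_mu z = z - z^-1], so [F_mu (- z^-1) = F_mu z].  The
    one meant is Bercovici and Voiculescu's, namely the inverse of the
    restriction of [F_mu] to some truncated cone on which it is injective.
    Since [F_mu z ~ z] at infinity in cones, its value at [w] does not depend
    on the cones chosen. *)
Definition right_inverse_on (mu : probR R) (lambda M alpha beta : R) : Prop :=
  [/\ 0 < lambda, 0 < M, 0 < alpha & 0 < beta] /\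
  {in trunc_cone alpha beta &, injective (recip_cauchy mu)} /\
  trunc_cone lambda M `<=` recip_cauchy mu @` trunc_cone alpha beta.

Definition right_inverse_rel (mu : probR R) (w v : R[i]) : Prop :=
  exists lambda M alpha beta : R,
    [/\ right_inverse_on mu lambda M alpha beta, trunc_cone lambda M w,
        trunc_cone alpha beta v & recip_cauchy mu v = w].

Definition right_inverse_dom (mu : probR R) : set R[i] :=
  [set w | exists v, right_inverse_rel mu w v].

Definition right_inverse (mu : probR R) (w : R[i]) : R[i] :=
  xget 0 [set v | right_inverse_rel mu w v].

(** Meaningful when [z^-1] lies in [right_inverse_dom mu]. *)
Definition free_cumulant (mu : probR R) (z : R[i]) : R[i] :=
  z * right_inverse mu z^-1 - 1.

Definition is_free_conv (mu rho tau : probR R) : Prop :=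
  forall z : R[i],
    right_inverse_dom mu z^-1 -> right_inverse_dom rho z^-1 ->
    right_inverse_dom tau z^-1 ->
    free_cumulant tau z = free_cumulant mu z + free_cumulant rho z.

(** [is_free_power n rho mu] says that [mu] is the free convolution of [n]
    copies of [rho]; the empty one is the unit mass at [0]. *)
Fixpoint is_free_power (n : nat) (rho mu : probR R) : Prop :=
  if n is k.+1 then
    exists2 sigma : probR R, is_free_power k rho sigma &
      is_free_conv sigma rho mu
  else forall A : set (measurableTypeR R), measurable A -> mu A = \d_(0 : R) A.

Definition freely_inf_div (mu : probR R) : Prop :=
  forall n : nat, (0 < n)%N -> exists rho : probR R, is_free_power n rho mu.

Definition levy_khintchine (eta a : R) (nu : measR R) (z : R[i]) : R[i] :=
  eta%:C * z + a%:C * z ^+ 2 +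
  cintegral nu (fun t =>
    (1 - t%:C * z)^-1 - 1 - t%:C * z * (\1_(`[-1, 1] : set R) t)%:C).

Definition free_char_triplet (mu : probR R)
    (eta a : R) (nu : measR R) : Prop :=
  [/\ 0 <= a,
      nu [set 0] = 0%E,
      (\int[nu]_t (Num.min 1 (t ^+ 2))%:E < +oo)%E &
      forall z : R[i], right_inverse_dom mu z^-1 ->
        free_cumulant mu z = levy_khintchine eta a nu z].

(** The analytic extension of [right_inverse mu] to the upper half-plane, for
    [mu] with free characteristic triplet [(eta, a, nu)]. *)
Definition right_inverse_ext (eta a : R) (nu : measR R) (z : R[i]) : R[i] :=
  z + z * levy_khintchine eta a nu z^-1.

Definition is_density (mu : probR R) (f : R -> R) : Prop :=
  (forall x, 0 <= f x) /\
  forall A : set (measurableTypeR R), measurable A ->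
    mu A = (\int[lebesgue_measure]_(x in A) (f x)%:E)%E.

End Defs.

(* Main.v *)
From HB Require Import structures.
Require Import Defs.
From mathcomp Require Import all_boot all_order all_algebra.
From mathcomp Require Import complex.
From mathcomp Require Import all_classical all_reals all_analysis.
From mathcomp Require Import measurable_realfun ring lra.
Import Order.TTheory GRing.Theory Num.Theory.
Import numFieldNormedType.Exports.
Import Normc.
Local Open Scope classical_set_scope.
Local Open Scope ring_scope.
Local Open Scope complex_scope.
Set Implicit Arguments.
Unset Strict Implicit.
Unset Printing Implicit Defensive.

(** Write [G] for the Cauchy transform of [mu], [F = 1 / G], and
    [H w = w + w C(1 / w)], where [C] is the Levy-Khintchine expression; [H] is
    defined on the whole upper half-plane, while the triplet only says that it
    agrees with the right inverse of [F] where the latter is defined.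

    Far out in a cone [F] is a small perturbation of the identity, so the right
    inverse exists there and [H (F z) = z] for [z] near [i Y], [Y] large.  Both
    sides are analytic in [z], hence [H (F z) = z] on the upper half-plane
    ([right_inverse_extK]).  The identity theorem is derived from the maximum
    principle for functions with a second order Taylor expansion at every
    point: averaging over [h, ih, -h, -ih] kills the linear and the quadratic
    term, which is all that the maximum principle needs.

    The Levy-Khintchine formula gives
      [Im (H w) = Im w * (1 - J w)],
      [H w - H w' = (w - w') * (1 - E w w')],
    with [J w = a / |w|^2 + int t^2 / |w - t|^2 dnu] and
    [E w w' = a / (w w') + int t^2 / ((w - t) (w' - t)) dnu].  So [J < 1] at
    every value [w = F z].  Since
      [2 Re (1 / ((w - t) (w' - t))) = 1 / |w - t|^2 + 1 / |w' - t|^2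
        - |w - conj w'|^2 / (|w - t|^2 |w' - t|^2)],
    the real part of [1 - E w w'] is at least
    [1 - (J w + J w') / 2 + c |w - w'|^2] for bounded [w, w'], where [c > 0]
    unless [a = 0] and [nu = 0].  Hence [|F z - F z'|^3 <= K |z - z'|] on
    bounded sets ([recip_cauchy_holder]): [F] extends continuously to the real
    line.  By Stieltjes inversion [mu] has the density
    [- Im (1 / F (x + i0)) / pi] on every interval where [F] stays away from
    zero, continuous there ([boundary_density_mass]).

    It remains to see where [F] can approach zero, and [J < 1] decides this.
    If [a > 0] then [|F|^2 > a].  If [nu] has mass larger than one then
    [J w >= 1] for small [w], by monotone convergence.  So in case (1) [F]
    stays away from zero everywhere.  If [a = 0] and [nu] has mass [q <= 1],
    then [H w = x0 + w * (1 + int t / (w - t) dnu)] with a bounded bracket for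
    [w = F z], so [|z - x0| <= 3 |F z|] and only [x0 = H (+i0)] can carry an
    atom or a singular part.  Its mass [m] is the limit of
    [i y G (x0 + i y) = 1 + int t / (w - t) dnu] with [w = F (x0 + i y)].  If
    [m > 0], then [|w| <= (2 / m) Im w] for small [y], so [w] tends to [0]
    non-tangentially and dominated convergence yields [m = 1 - q]
    ([atom_mass]).  For [q = 1] this excludes [m > 0]; for [q < 1] the real
    part of the bracket is at least [(1 - q) / 2], so that [m > 0]
    ([atom_mass_ge]). *)

Local Notation Re := complex.Re.
Local Notation Im := complex.Im.

(** * The real-valued modulus of complex numbers *)
Section ComplexNorm.
Variable R : realType.
Implicit Types (z w : R[i]) (x y : R).

Lemma cReD z w : Re (z + w) = Re z + Re w. Proof. by case: z; case: w. Qed.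
Lemma cImD z w : Im (z + w) = Im z + Im w. Proof. by case: z; case: w. Qed.
Lemma cReB z w : Re (z - w) = Re z - Re w. Proof. by case: z; case: w. Qed.
Lemma cImB z w : Im (z - w) = Im z - Im w. Proof. by case: z; case: w. Qed.
Lemma cReM z w : Re (z * w) = Re z * Re w - Im z * Im w.
Proof. by case: z; case: w. Qed.
Lemma cImM z w : Im (z * w) = Re z * Im w + Im z * Re w.
Proof. by case: z; case: w. Qed.
Lemma cReV z : Re z^-1 = Re z / (Re z ^+ 2 + Im z ^+ 2).
Proof. by case: z. Qed.
Lemma cImV z : Im z^-1 = - Im z / (Re z ^+ 2 + Im z ^+ 2).
Proof. by case: z => a b; rewrite mulNr. Qed.

Lemma normc_ge0 z : 0 <= normc z.
Proof. by case: z => a b; exact: sqrtr_ge0. Qed.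

Lemma sqr_normcE z : normc z ^+ 2 = Re z ^+ 2 + Im z ^+ 2.
Proof. by case: z => a b; rewrite sqr_sqrtr// addr_ge0// sqr_ge0. Qed.

Lemma normcD z w : normc (z + w) <= normc z + normc w.
Proof. exact: le_normcD. Qed.

Lemma normc_opp z : normc (- z) = normc z.
Proof. exact: complex.normcN. Qed.

Lemma normcB z w : normc (z - w) <= normc z + normc w.
Proof. by rewrite -(normc_opp w) normcD. Qed.

Lemma normcBC z w : normc (z - w) = normc (w - z).
Proof. by rewrite -normc_opp opprB. Qed.

Lemma normcBr z w : normc z - normc w <= normc (z - w).
Proof. by rewrite lerBlDr; have := normcD (z - w) w; rewrite subrK. Qed.

Lemma normcX z n : normc (z ^+ n) = normc z ^+ n.
Proof.
elim: n => [|n IH]; first by rewrite !expr0 normc1.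
by rewrite !exprS normcM IH.
Qed.

Lemma normc_real x : normc x%:C = `|x|.
Proof. by rewrite /= expr0n/= addr0 sqrtr_sqr. Qed.

Lemma normc_eq0 z : (normc z == 0) = (z == 0).
Proof.
by apply/eqP/eqP => [|->]; [exact: eq0_normc|exact: normc0].
Qed.

Lemma normc_gt0 z : (0 < normc z) = (z != 0).
Proof. by rewrite lt_def normc_ge0 andbT normc_eq0. Qed.

Lemma Re_le_normc z : `|Re z| <= normc z.
Proof.
rewrite -(@ler_pXn2r _ 2)// ?nnegrE ?normc_ge0// sqr_normcE real_normK ?num_real//.
by rewrite lerDl sqr_ge0.
Qed.

Lemma Im_le_normc z : `|Im z| <= normc z.
Proof.
rewrite -(@ler_pXn2r _ 2)// ?nnegrE ?normc_ge0// sqr_normcE real_normK ?num_real//.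
by rewrite lerDr sqr_ge0.
Qed.

Lemma normc_le z : normc z <= `|Re z| + `|Im z|.
Proof.
rewrite -(@ler_pXn2r _ 2)// ?nnegrE ?normc_ge0 ?addr_ge0// sqr_normcE.
rewrite sqrrD !real_normK ?num_real// -addrA lerD2l lerDr mulrn_wge0//.
Qed.

Lemma complexP z w : Re z = Re w -> Im z = Im w -> z = w.
Proof. by case: z w => [a b] [c d] /= -> ->. Qed.

Lemma Im_gt0_neq0 z : 0 < Im z -> z != 0.
Proof. by move=> z0; apply/eqP => ze; rewrite ze ltxx in z0. Qed.

Lemma subr_real_neq0 z x : 0 < Im z -> z - x%:C != 0.
Proof. by move=> z0; apply: Im_gt0_neq0; rewrite cImB subr0. Qed.

Lemma Im_le_normc_sub z x : Im z <= normc (z - x%:C).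
Proof.
by apply: le_trans (Im_le_normc _); rewrite cImB subr0 ler_norm.
Qed.

End ComplexNorm.

(** * Integration of complex functions *)
Section MeasurableInverse.
Variable R : realType.

Lemma measurable_funV_ge0 (disp : measure_display) (T : measurableType disp) (k : T -> R) :
  (forall u, 0 <= k u) -> measurable_fun setT k ->
  measurable_fun setT (fun u => (k u)^-1).
Proof.
move=> k0 mk; under eq_fun do rewrite -powR_inv1//.
by apply: (@measurableT_comp _ _ _ T _ _ ((@powR R)^~ (-1))) mk; exact: measurable_powR.
Qed.

End MeasurableInverse.

Section CIntegral.
Variables (R : realType) (m : measR R).
Implicit Types (f g : R -> R[i]) (k : R -> R).

Definition rint k := m.-integrable setT (EFin \o k).
(** Measurability and integrability are componentwise, to match the
    componentwise definition of [cintegral]. *)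
Definition cmeas f :=
  measurable_fun (setT : set (measurableTypeR R)) (fun t => Re (f t)) /\
  measurable_fun (setT : set (measurableTypeR R)) (fun t => Im (f t)).
Definition cint f := rint (fun t => Re (f t)) /\ rint (fun t => Im (f t)).

Lemma cmeas_cst c : cmeas (fun=> c).
Proof. by split; exact: measurable_cst. Qed.

Lemma cmeas_real k :
  measurable_fun (setT : set (measurableTypeR R)) k -> cmeas (fun t => (k t)%:C).
Proof. by split => //; exact: measurable_cst. Qed.

Lemma cmeas_id : cmeas (fun t => t%:C).
Proof. by apply: cmeas_real; exact: measurable_id. Qed.

Lemma cmeasD f g : cmeas f -> cmeas g -> cmeas (fun t => f t + g t).
Proof.
move=> [mf mf'] [mg mg']; split.
  by under eq_fun do rewrite cReD; exact: measurable_funD.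
by under eq_fun do rewrite cImD; exact: measurable_funD.
Qed.

Lemma cmeasM f g : cmeas f -> cmeas g -> cmeas (fun t => f t * g t).
Proof.
move=> [mf mf'] [mg mg']; split.
  under eq_fun do rewrite cReM; apply: measurable_funB;
  exact: measurable_funM.
under eq_fun do rewrite cImM; apply: measurable_funD;
exact: measurable_funM.
Qed.

Lemma cmeasN f : cmeas f -> cmeas (fun t => - f t).
Proof.
move=> mf; have := cmeasM (cmeas_cst (-1)) mf.
by under eq_fun do rewrite mulN1r.
Qed.

Lemma cmeasB f g : cmeas f -> cmeas g -> cmeas (fun t => f t - g t).
Proof. by move=> mf mg; apply: cmeasD => //; exact: cmeasN. Qed.

Lemma cmeasV f : (forall t, f t != 0) -> cmeas f -> cmeas (fun t => (f t)^-1).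
Proof.
move=> f0 [mf mf'].
have md : measurable_fun (setT : set (measurableTypeR R))
    (fun t => (Re (f t) ^+ 2 + Im (f t) ^+ 2)^-1).
  apply: measurable_funV_ge0; first by move=> t; rewrite -sqr_normcE sqr_ge0.
  by apply: measurable_funD; exact: measurable_funX.
split.
  under eq_fun do rewrite cReV.
  exact: measurable_funM.
under eq_fun do rewrite cImV.
by apply: measurable_funM => //;
  exact: measurable_funN.
Qed.

Lemma rint_le k l :
  measurable_fun (setT : set (measurableTypeR R)) k -> rint l ->
  (forall t, `|k t| <= l t) -> rint k.
Proof.
move=> mk il kl; apply: (le_integrable _ _ _ il) => //.
  exact/measurable_EFinP.
move=> t _ /=; rewrite lee_fin (le_trans (kl t))// ler_norm//.
Qed.

Lemma rint_meas k : rint k -> measurable_fun (setT : set (measurableTypeR R)) k.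
Proof. by move/measurable_int/measurable_EFinP. Qed.

Lemma rintD k l : rint k -> rint l -> rint (fun t => k t + l t).
Proof. by move=> ik il; exact: (integrableD _ ik il). Qed.

Lemma rintZ (c : R) k : rint k -> rint (fun t => c * k t).
Proof. by move=> ik; exact: (integrableZl _ c ik). Qed.

Lemma rintN k : rint k -> rint (fun t => - k t).
Proof.
move=> /(rintZ (-1)); congr (rint _); apply/funext => t; exact: mulN1r.
Qed.

Lemma rintB k l : rint k -> rint l -> rint (fun t => k t - l t).
Proof. by move=> ik il; apply: rintD => //; exact: rintN. Qed.

Lemma cint_dom f k : cmeas f -> rint k -> (forall t, normc (f t) <= k t) ->
  cint f.
Proof.
move=> [mf mf'] ik fk; split; apply: rint_le ik _ => // t;
  by apply: le_trans (fk t); rewrite (Re_le_normc, Im_le_normc).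
Qed.

Lemma cintegralD f g : cint f -> cint g ->
  cintegral m (fun t => f t + g t) = cintegral m f + cintegral m g.
Proof.
move=> [f1 f2] [g1 g2]; apply: complexP => /=.
  under eq_Rintegral do rewrite cReD; exact: RintegralD.
under eq_Rintegral do rewrite cImD; exact: RintegralD.
Qed.

Lemma cintegralZ c f : cint f ->
  cintegral m (fun t => c * f t) = c * cintegral m f.
Proof.
move=> [f1 f2]; apply: complexP; rewrite ?cReM ?cImM /=.
  under eq_Rintegral do rewrite cReM.
  by rewrite RintegralB ?RintegralZl//; exact: rintZ.
under eq_Rintegral do rewrite cImM.
by rewrite RintegralD ?RintegralZl//; exact: rintZ.
Qed.

Lemma cintZ c f : cint f -> cint (fun t => c * f t).
Proof.
move=> [f1 f2]; split.
  by under eq_fun do rewrite cReM; apply: rintB; exact: rintZ.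
by under eq_fun do rewrite cImM; apply: rintD; exact: rintZ.
Qed.

Lemma cintegralN f : cint f ->
  cintegral m (fun t => - f t) = - cintegral m f.
Proof.
move=> fi; rewrite -mulN1r -cintegralZ//; congr cintegral.
by apply/funext => t; rewrite mulN1r.
Qed.

Lemma cintD f g : cint f -> cint g -> cint (fun t => f t + g t).
Proof.
move=> [f1 f2] [g1 g2]; split.
  by under eq_fun do rewrite cReD; exact: rintD.
by under eq_fun do rewrite cImD; exact: rintD.
Qed.

Lemma cintN f : cint f -> cint (fun t => - f t).
Proof.
by move=> /(cintZ (-1)); under eq_fun do rewrite mulN1r.
Qed.

Lemma cintegralB f g : cint f -> cint g ->
  cintegral m (fun t => f t - g t) = cintegral m f - cintegral m g.
Proof. by move=> fi gi; rewrite cintegralD ?cintegralN//; exact: cintN. Qed.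

Lemma cint_cmeas f : cint f -> cmeas f.
Proof. by move=> [f1 f2]; split; [exact: (rint_meas f1)|exact: (rint_meas f2)]. Qed.

Lemma cintegral_real k : cintegral m (fun t => (k t)%:C) = (Rintegral m setT k)%:C.
Proof.
by apply: complexP => //=; rewrite Rintegral_cst// mul0r.
Qed.

(** The constant [2] comes from bounding real and imaginary parts separately;
    a sharp triangle inequality is never used. *)
Lemma normc_cintegral f k : cmeas f -> rint k ->
  (forall t, normc (f t) <= k t) ->
  normc (cintegral m f) <= 2 * Rintegral m setT k.
Proof.
move=> mf ik fk; have [f1 f2] := cint_dom mf ik fk.
apply: le_trans (normc_le _) _ => /=; rewrite mulrDl !mul1r; apply: lerD.
  apply: le_trans (le_normr_Rintegral _ _) _ => //.
  apply: le_Rintegral => //; first exact: integrable_norm.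
  by move=> t _; apply: le_trans (Re_le_normc _) _.
apply: le_trans (le_normr_Rintegral _ _) _ => //.
apply: le_Rintegral => //; first exact: integrable_norm.
by move=> t _; apply: le_trans (Im_le_normc _) _.
Qed.

Lemma Rintegral_dominated_cvg (k_ : nat -> R -> R) (k l : R -> R) :
  (forall n, measurable_fun (setT : set (measurableTypeR R)) (k_ n)) ->
  rint l -> (forall n t, `|k_ n t| <= l t) ->
  (forall t, k_ ^~ t @ \oo --> k t) ->
  Rintegral m setT (k_ n) @[n --> \oo] --> Rintegral m setT k.
Proof.
move=> mk il kl kk.
have mk' : measurable_fun (setT : set (measurableTypeR R)) k.
  by apply: (@measurable_fun_cvg _ _ R setT k_ k mk) => t _; exact: kk.
have ik_ n : rint (k_ n) by apply: rint_le il _.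
have ik : rint k.
  apply: rint_le il _ => // t.
  by apply: (cvgr_to_le (cvg_norm (kk t))); exact: nearW.
have aek : {ae m, forall t, setT t ->
    (fun n => (EFin \o k_ n) t) @ \oo --> (EFin \o k) t}.
  by apply: aeW => t _; apply: cvg_EFin; [exact: nearW|exact: kk].
have ael : {ae m, forall t n, setT t -> (`|(EFin \o k_ n) t| <= (EFin \o l) t)%E}.
  by apply: aeW => t n _ /=; rewrite lee_fin.
have [_ _] := @dominated_convergence _ _ R m setT measurableT
  (fun n => EFin \o k_ n) (EFin \o k) (EFin \o l)
  (fun n => measurable_int _ (ik_ n)) (measurable_int _ ik) aek il ael.
rewrite -(fineK (integrable_fin_num measurableT ik)) => H.
exact: (fine_cvg H).
Qed.

End CIntegral.

(** * Functions with second order Taylor expansions *)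
Section BigO.
Variable R : realType.
Local Notation C := R[i].
Implicit Types (f g : C -> C) (z w h p c : C).

Definition bigO (n : nat) (rho : C -> C) := exists K d : R,
  [/\ 0 <= K, 0 < d & forall h, normc h < d -> normc (rho h) <= K * normc h ^+ n].

Lemma bigO_ext n (rho sigma : C -> C) : (forall h, rho h = sigma h) ->
  bigO n rho -> bigO n sigma.
Proof. by move=> e; congr (bigO n _); apply/funext. Qed.

Lemma bigOD n rho sigma : bigO n rho -> bigO n sigma ->
  bigO n (fun h => rho h + sigma h).
Proof.
move=> [K [d [K0 d0 H]]] [K' [d' [K0' d0' H']]].
exists (K + K'), (Num.min d d'); split; rewrite ?addr_ge0 ?lt_min ?d0//.
move=> h; rewrite lt_min => /andP[hd hd'].
by apply: le_trans (normcD _ _) _; rewrite mulrDl lerD ?H ?H'.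
Qed.

Lemma bigOM n k rho sigma : bigO n rho -> bigO k sigma ->
  bigO (n + k) (fun h => rho h * sigma h).
Proof.
move=> [K [d [K0 d0 H]]] [K' [d' [K0' d0' H']]].
exists (K * K'), (Num.min d d'); split; rewrite ?mulr_ge0 ?lt_min ?d0//.
move=> h; rewrite lt_min => /andP[hd hd'].
by rewrite normcM exprD mulrACA ler_pM ?normc_ge0 ?H ?H'.
Qed.

Lemma bigO_cst c : bigO 0 (fun=> c).
Proof.
by exists (normc c), 1; split; rewrite ?normc_ge0// => h _; rewrite expr0 mulr1.
Qed.

Lemma bigO_id : bigO 1 id.
Proof. by exists 1, 1; split=> // h _; rewrite mul1r expr1. Qed.

Lemma bigO_exp n : bigO n (fun h => h ^+ n).
Proof. by exists 1, 1; split=> // h _; rewrite mul1r normcX. Qed.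

Lemma bigOW k n rho : (k <= n)%N -> bigO n rho -> bigO k rho.
Proof.
move=> kn [K [d [K0 d0 H]]]; exists K, (Num.min d 1); split=> //.
  by rewrite lt_min d0 ltr01.
move=> h; rewrite lt_min => /andP[hd h1]; apply: le_trans (H _ hd) _.
by rewrite ler_wpM2l// ler_wiXn2l ?normc_ge0// ltW.
Qed.

Lemma bigOZ n c rho : bigO n rho -> bigO n (fun h => c * rho h).
Proof. by move=> H; rewrite -[n]add0n; apply: bigOM => //; exact: bigO_cst. Qed.

Lemma bigO_comp n rho sigma : bigO n rho -> bigO 1 sigma ->
  bigO n (fun h => rho (sigma h)).
Proof.
move=> [K [d [K0 d0 H]]] [K' [d' [K0' d0' H']]].
exists (K * K' ^+ n), (Num.min d' (d / (K' + 1))).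
have K1 : 0 < K' + 1 by rewrite ltr_wpDl.
split; rewrite ?mulr_ge0 ?exprn_ge0// ?lt_min ?d0' ?divr_gt0//.
move=> h; rewrite lt_min => /andP[hd hd'].
have sh : normc (sigma h) <= K' * normc h by rewrite -[normc h]expr1 H'.
apply: le_trans (H _ _) _.
  apply: le_lt_trans sh _; rewrite ltr_pdivlMr// in hd'.
  apply: le_lt_trans hd'; rewrite mulrC ler_wpM2l ?normc_ge0// lerDl ler01.
  by [].
by rewrite -mulrA -exprMn ler_wpM2l// lerXn2r// ?nnegrE ?mulr_ge0 ?normc_ge0.
Qed.

(** A pointwise substitute for analyticity: it is stable under algebraic
    operations and composition, holds for Cauchy transforms by the geometric
    expansion of the kernel, and suffices for the maximum principle. *)
Definition taylor2 f z := exists f1 f2 : C,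
  bigO 3 (fun h => f (z + h) - (f z + f1 * h + f2 * h ^+ 2)).

Lemma taylor2_bigO1 f z : taylor2 f z -> bigO 1 (fun h => f (z + h) - f z).
Proof.
move=> [f1 [f2 H]].
apply: (@bigO_ext _ (fun h => (f (z + h) - (f z + f1 * h + f2 * h ^+ 2)) +
  (f1 * h + f2 * h ^+ 2))); first by move=> h; ring.
apply: bigOD; first exact: (bigOW _ H).
apply: bigOD; apply: bigOZ; first exact: bigO_id.
exact: (bigOW _ (bigO_exp 2)).
Qed.

Lemma taylor2_local f g z (d : R) : 0 < d ->
  (forall h, normc h < d -> f (z + h) = g (z + h)) -> taylor2 f z -> taylor2 g z.
Proof.
move=> d0 fg [f1 [f2 [K [d' [K0 d0' H]]]]]; exists f1, f2, K, (Num.min d d').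
split=> //; first by rewrite lt_min d0.
move=> h; rewrite lt_min => /andP[hd hd']; rewrite -fg//.
have <- : f z = g z by have := fg 0; rewrite normc0 addr0 => ->.
exact: H.
Qed.

Lemma taylor2_cst c z : taylor2 (fun=> c) z.
Proof.
exists 0, 0; apply: (@bigO_ext _ (fun=> 0)); first by move=> h; ring.
by exists 0, 1; split=> // h _; rewrite normc0 mul0r.
Qed.

Lemma taylor2_id z : taylor2 id z.
Proof.
exists 1, 0; apply: (@bigO_ext _ (fun=> 0)); first by move=> h; ring.
by exists 0, 1; split=> // h _; rewrite normc0 mul0r.
Qed.

Lemma taylor2D f g z : taylor2 f z -> taylor2 g z ->
  taylor2 (fun z => f z + g z) z.
Proof.
move=> [f1 [f2 H]] [g1 [g2 H']]; exists (f1 + g1), (f2 + g2).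
by apply: bigO_ext (bigOD H H') => h; ring.
Qed.

Lemma taylor2M f g z : taylor2 f z -> taylor2 g z ->
  taylor2 (fun z => f z * g z) z.
Proof.
move=> tf tg; have gO := taylor2_bigO1 tg.
move: tf tg => [f1 [f2 H]] [g1 [g2 H']].
exists (f1 * g z + f z * g1), (f2 * g z + f1 * g1 + f z * g2).
have := bigOM H (bigO_cst (g z)); rewrite addn0 => E1.
have := bigOM H gO; move/(@bigOW 3 4 _ isT) => E2.
have := bigOZ (f z) H' => E3.
have := bigOM (bigOZ f1 bigO_id) H'; move/(@bigOW 3 4 _ isT) => E4.
have := bigOM (bigOZ f2 (bigO_exp 2)) gO => E5.
have E6 : bigO 3 (fun h => f1 * g2 * h ^+ 3) by apply: bigOZ; exact: bigO_exp.
apply: bigO_ext (bigOD (bigOD E1 E2) (bigOD E3 (bigOD E4 (bigOD E5 E6)))) => h.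
ring.
Qed.

Lemma taylor2_comp f g z : taylor2 g z -> taylor2 f (g z) ->
  taylor2 (fun z => f (g z)) z.
Proof.
move=> tg [f1 [f2 H]]; have gO := taylor2_bigO1 tg.
move: tg => [g1 [g2 H']].
exists (f1 * g1), (f1 * g2 + f2 * g1 ^+ 2).
have E1 := bigO_comp H gO.
have E2 := bigOZ f1 H'.
have k2 : bigO 2 (fun h => g (z + h) - g z - g1 * h).
  apply: bigO_ext (bigOD (bigOW (isT : (2 <= 3)%N) H') (bigOZ g2 (bigO_exp 2))) => h.
  ring.
have k1 : bigO 1 (fun h => g (z + h) - g z + g1 * h).
  by apply: bigOD gO _; apply: bigOZ bigO_id.
have E3 := bigOZ f2 (bigOM k2 k1).
apply: bigO_ext (bigOD E1 (bigOD E2 E3)) => h.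
rewrite (_ : g z + (g (z + h) - g z) = g (z + h)); last by ring.
ring.
Qed.

Lemma taylor2V z : z != 0 -> taylor2 (fun z => z^-1) z.
Proof.
move=> z0; exists (- z^-1 ^+ 2), (z^-1 ^+ 3).
have nz : 0 < normc z by rewrite normc_gt0.
exists (2 * (normc z)^-1 ^+ 4), (normc z / 2); split.
- by rewrite mulr_ge0// exprn_ge0// invr_ge0 ltW.
- by rewrite divr_gt0.
move=> h hz.
have nzh : normc z / 2 <= normc (z + h).
  by have := normcBr z (- h); rewrite opprK normc_opp; lra.
have zh0 : z + h != 0 by rewrite -normc_gt0 (lt_le_trans _ nzh)// divr_gt0.
rewrite (_ : _ - _ = - (z^-1 ^+ 3 * (z + h)^-1 * h ^+ 3)); last first.
  by field; rewrite z0 zh0.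
rewrite normc_opp normcM normcX normcM normcX !normcV ler_wpM2r ?exprn_ge0 ?normc_ge0//.
rewrite [X in _ <= X](_ : _ = (normc z)^-1 ^+ 3 * (normc z / 2)^-1); last first.
  by field; rewrite gt_eqF.
by rewrite ler_wpM2l ?exprn_ge0 ?invr_ge0 ?normc_ge0// lef_pV2// posrE ?divr_gt0 ?normc_gt0.
Qed.

Lemma taylor2N f z : taylor2 f z -> taylor2 (fun z => - f z) z.
Proof.
move=> [f1 [f2 H]]; exists (- f1), (- f2).
by apply: bigO_ext (bigOZ (-1) H) => h; ring.
Qed.

Lemma taylor2X f z n : taylor2 f z -> taylor2 (fun z => f z ^+ n) z.
Proof.
move=> tf; elim: n => [|n IH].
  by under eq_fun do rewrite expr0; exact: taylor2_cst.
by under eq_fun do rewrite exprS; exact: taylor2M.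
Qed.

End BigO.

(** * The maximum principle and the identity theorem *)
Section MaximumPrinciple.
Variable R : realType.
Local Notation C := R[i].
Implicit Types (f g : C -> C) (z w h p c : C) (r : R).

Definition square p r : set C :=
  [set z | `|Re (z - p)| <= r /\ `|Im (z - p)| <= r].

Definition square_interior p r : set C :=
  [set z | `|Re (z - p)| < r /\ `|Im (z - p)| < r].

Definition ccontinuous (u : C -> R) z := forall e : R, 0 < e ->
  exists2 d : R, 0 < d & forall h, normc h < d -> `|u (z + h) - u z| < e.

(** Squares replace discs because they are products of compact intervals. *)
Lemma EVT_square (u : C -> R) p r : 0 <= r ->
  (forall z, square p r z -> ccontinuous u z) ->
  exists2 c, square p r c & forall z, square p r z -> u z <= u c.
Proof.
move=> r0 uc.
pose A : set (R * R) := `[Re p - r, Re p + r] `*` `[Im p - r, Im p + r].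
pose f (x : R * R) := u (x.1 +i* x.2).
have AE x : A x <-> square p r (x.1 +i* x.2).
  case: x => a b; rewrite /A /square /= !in_itv/= cReB cImB /= !ler_norml.
  by split=> -[/andP[? ?] /andP[? ?]]; split; apply/andP; split; lra.
have cA : compact A by apply: compact_setX; exact: segment_compact.
have A0 : A !=set0.
  exists (Re p, Im p); rewrite AE /square /=; case: (p) => a b /=.
  by rewrite !subrr normr0.
have cf : {within A, continuous f}.
  apply: continuous_in_subspaceT => -[a b]; rewrite inE => /AE/uc /= H.
  apply/cvgrPdist_lt => e /H[d d0 {}H].
  have d20 : 0 < d / 2 by rewrite divr_gt0.
  exists (ball a (d / 2), ball b (d / 2)); first by split; exact: nbhsx_ballx.
  move=> [a' b'] [/= ha hb]; rewrite distrC /f /=.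
  have -> : a' +i* b' = (a +i* b) + ((a' - a) +i* (b' - b)).
    by apply: complexP => /=; rewrite addrC subrK.
  apply: H; apply: le_lt_trans (normc_le _) _ => /=.
  rewrite -ball_normE /= in ha; rewrite -ball_normE /= in hb.
  by rewrite distrC (distrC b'); lra.
have [[a b] /set_mem/AE cin cmax] := compact_EVT_max A0 cA cf.
exists (a +i* b) => // -[x y] zin.
by apply: (cmax (x, y)); apply/mem_set/AE.
Qed.

Lemma ccontinuousN (u : C -> R) z : ccontinuous u z -> ccontinuous (fun z => - u z) z.
Proof.
move=> uc e /uc[d d0 H]; exists d => // h /H.
by rewrite -opprD normrN.
Qed.

Lemma bigO1_small (rho : C -> C) (e : R) : bigO 1 rho -> 0 < e ->
  exists2 d : R, 0 < d & forall h, normc h < d -> normc (rho h) < e.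
Proof.
move=> [K [d [K0 d0 H]]] e0; exists (Num.min d (e / (K + 1))).
  by rewrite lt_min d0 divr_gt0// ltr_wpDl.
move=> h; rewrite lt_min => /andP[hd he].
apply: le_lt_trans (H _ hd) _; rewrite expr1.
rewrite ltr_pdivlMr ?ltr_wpDl// in he.
by apply: le_lt_trans he; rewrite mulrC ler_wpM2l ?normc_ge0// lerDl.
Qed.

Lemma taylor2_ccontinuous_normc f z :
  taylor2 f z -> ccontinuous (fun z => normc (f z)) z.
Proof.
move=> /taylor2_bigO1 H e /(bigO1_small H)[d d0 {}H]; exists d => // h /H.
apply: le_lt_trans; rewrite ler_norml normcBr andbT lerNl opprB.
by rewrite normcBC normcBr.
Qed.

(** At an interior maximum [c] of [Re f + e |z - p|^2], the average over the
    four points [c + h] with [h] in [s, -s, is, -is] sees neither the linear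
    nor the quadratic term of [f]; so it exceeds the value at [c] by
    [e s^2 + O(s^3)], a contradiction. *)
Lemma max_principle_Re f p r (B : R) : 0 < r ->
  (forall z, square p r z -> taylor2 f z) ->
  (forall z, square p r z -> ~ square_interior p r z -> Re (f z) <= B) ->
  forall z, square p r z -> Re (f z) <= B.
Proof.
move=> r0 tf fB z0 z0in; rewrite leNgt; apply/negP => Bz0.
pose e := (Re (f z0) - B) / (4 * r ^+ 2).
have r20 : 0 < r ^+ 2 by rewrite exprn_gt0.
have e0 : 0 < e by rewrite divr_gt0 ?subr_gt0// mulr_gt0.
pose q z := Re (z - p) ^+ 2 + Im (z - p) ^+ 2.
have qle z : square p r z -> q z <= 2 * r ^+ 2.
  move=> [h1 h2]; rewrite /q -(real_normK (num_real (Re _))).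
  rewrite -(real_normK (num_real (Im _))) mulrDl mul1r.
  by rewrite lerD// lerXn2r// nnegrE ltW.
have q0 z : 0 <= q z by rewrite addr_ge0// sqr_ge0.
pose u z := Re (f z) + e * q z.
have uc z : square p r z -> ccontinuous u z.
  move=> zin; have H1 := taylor2_bigO1 (tf _ zin).
  have H2 : bigO 1 (fun h => (q (z + h) - q z)%:C).
    exists (2 * normc (z - p) + 1), 1; split=> //.
      by rewrite addr_ge0// mulr_ge0// normc_ge0.
    move=> h h1; rewrite normc_real expr1 /q -!sqr_normcE subr_sqr normrM mulrC.
    have hn : `|normc (z + h - p) - normc (z - p)| <= normc h.
      rewrite (_ : z + h - p = z - p + h); last by ring.
      rewrite ler_norml lerBlDl normcD andbT lerBrDl.
      by have := normcD (z - p + h) (- h); rewrite addrK normc_opp; lra.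
    rewrite ler_pM// ger0_norm ?addr_ge0 ?normc_ge0//.
    by move: hn; rewrite ler_norml; lra.
  move=> d /(bigO1_small (bigOD H1 (bigOZ e%:C H2)))[d' d'0 H]; exists d' => // h /H.
  apply: le_lt_trans; apply: le_trans _ (Re_le_normc _).
  by rewrite /u cReD cReB cReM /= mul0r subr0 mulrBr opprD addrACA.
have [c cin cmax] := EVT_square (ltW r0) uc.
have [ci|cb] := pselect (square_interior p r c); last first.
  have := cmax _ z0in; apply/negP; rewrite -ltNge.
  have := fB _ cin cb; have := qle _ cin; have := q0 z0.
  have fz0 : Re (f z0) = B + 4 * r ^+ 2 * e.
    by rewrite /e; field; rewrite gt_eqF.
  rewrite /u fz0 => h1 h2 h3.
  have h4 : 0 <= e * q z0 by rewrite mulr_ge0// ltW.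
  have h5 : e * q c <= e * (2 * r ^+ 2) by rewrite ler_pM2l.
  have h6 : 0 < r ^+ 2 * e by rewrite mulr_gt0.
  lra.
have [f1 [f2 [K [d [K0 d0 H]]]]] := tf _ cin.
(* [s] small enough for the four points to stay in the square and for the
   cubic error [K s^3] to be dominated by the gain [e s^2] *)
pose s0 := Num.min (r - `|Re (c - p)|) (r - `|Im (c - p)|).
pose s := Num.min (Num.min (d / 2) s0) (e / (K + 1) / 2).
have s00 : 0 < s0 by case: ci => ? ?; rewrite lt_min !subr_gt0; apply/andP.
have sp : 0 < s.
  rewrite lt_min; apply/andP; split.
    by rewrite lt_min s00 andbT divr_gt0.
  by apply: divr_gt0 => //; apply: divr_gt0 => //; rewrite ltr_wpDl.
have [sd [ss0 se]] : s <= d / 2 /\ s <= s0 /\ s <= e / (K + 1) / 2.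
  have : s <= s by [].
  by rewrite {2}/s le_min => /andP[+ ->]; rewrite le_min => /andP[-> ->].
have sq (h : C) : normc h = s -> square p r (c + h).
  move=> hs; move: ss0; rewrite le_min !lerBrDl => /andP[h1 h2]; split.
    rewrite (_ : c + h - p = (c - p) + h); last by ring.
    rewrite cReD; apply: le_trans (ler_normD _ _) _; apply: le_trans h1.
    by rewrite lerD2l -hs Re_le_normc.
  rewrite (_ : c + h - p = (c - p) + h); last by ring.
  rewrite cImD; apply: le_trans (ler_normD _ _) _; apply: le_trans h2.
  by rewrite lerD2l -hs Im_le_normc.
have low (h : C) : normc h = s ->
    Re (f c + f1 * h + f2 * h ^+ 2) - K * s ^+ 3 + e * q (c + h) <= u c.
  move=> hs; apply: le_trans (cmax _ (sq _ hs)); rewrite /u lerD2r.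
  have hd : normc h < d by rewrite hs; lra.
  have := le_trans (Re_le_normc _) (H _ hd).
  by rewrite hs cReB ler_norml => /andP[+ _]; lra.
have n1 : normc (s%:C) = s by rewrite normc_real gtr0_norm.
have n2 : normc (s%:C * 'i%C) = s.
  by rewrite normcM n1 /= expr0n expr1n add0r sqrtr1 mulr1.
have := low _ n1; have := low (- s%:C); rewrite normc_opp n1 => /(_ erefl).
have := low _ n2; have := low (- (s%:C * 'i%C)); rewrite normc_opp n2 => /(_ erefl).
rewrite /u /q; case: (c) (p) (f c) (f1) (f2) => [cx cy] [px py] [a b] [a1 b1] [a2 b2] /=.
rewrite !expr2 /=.
move=> h1 h2 h3 h4.
have h5 : e * s ^+ 2 <= K * s ^+ 3 by lra.
have h6 : e <= K * s.
  by move: h5; rewrite [X in _ <= _ * X]exprS mulrA ler_pM2r ?exprn_gt0.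
have h7 : (K + 1) * s <= e / 2.
  rewrite (_ : e / 2 = (K + 1) * (e / (K + 1) / 2)).
    by rewrite ler_pM2l// ltr_wpDl.
  by field; rewrite gt_eqF// ltr_wpDl.
lra.
Qed.

Lemma square_in p r z : normc (z - p) <= r -> square p r z.
Proof.
by move=> h; split; apply: le_trans h; rewrite (Re_le_normc, Im_le_normc).
Qed.

Lemma square_boundary p r z : ~ square_interior p r z -> r <= normc (z - p).
Proof.
move=> h; rewrite leNgt; apply/negP => hz; apply: h.
by split; apply: le_lt_trans hz; rewrite (Re_le_normc, Im_le_normc).
Qed.

(** As [f] vanishes near [p], [f z * (z - p)^-n] still has Taylor expansions at
    [p].  The maximum principle bounds it at [z] by [M / r^n], so that
    [|f z| <= M (|z - p| / r)^n] for all [n]. *)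
Lemma identity_principle f p r (d : R) : 0 < r -> 0 < d ->
  (forall z, square p r z -> taylor2 f z) ->
  (forall z, normc (z - p) < d -> f z = 0) ->
  forall z, normc (z - p) < r -> f z = 0.
Proof.
move=> r0 d0 tf f0 z zr.
have [c cin cmax] := EVT_square (ltW r0)
  (fun w win => taylor2_ccontinuous_normc (tf w win)).
set M := normc (f c) in cmax.
have zin : square p r z by apply: square_in; exact: ltW.
have [->|zp] := eqVneq z p; first by rewrite f0// subrr normc0.
have zp0 : z - p != 0 by rewrite subr_eq0.
suff bound n : normc (f z) <= M * (normc (z - p) / r) ^+ n.
  apply/eqP; rewrite -normc_eq0; apply/eqP/le_anti; rewrite normc_ge0 andbT.
  have q1 : `|normc (z - p) / r| < 1.
    by rewrite ger0_norm ?divr_ge0 ?normc_ge0 ?ltW// ltr_pdivrMr// mul1r.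
  have : M * (normc (z - p) / r) ^+ n @[n --> \oo] --> M * 0.
    by apply: cvgMl_tmp; exact: cvg_expr.
  rewrite mulr0 => /cvgr_to_ge; apply; exact: nearW.
(* the factor [conjc A] turns the bound on real parts into one on moduli *)
pose A := f z * (z - p)^-1 ^+ n.
pose g w := conjc A * (f w * (w - p)^-1 ^+ n).
have tg w : square p r w -> taylor2 g w.
  move=> win; have [wp|wp] := eqVneq w p.
    apply: (@taylor2_local _ (fun=> 0) _ _ _ d0); last exact: taylor2_cst.
    by move=> h hd; rewrite /g wp f0 ?mul0r ?mulr0// addrC addKr.
  apply: taylor2M; first exact: taylor2_cst.
  apply: taylor2M; first exact: tf.
  apply: taylor2X; apply: (@taylor2_comp _ (fun z => z^-1) (fun w => w - p)).
    by apply: taylor2D; [exact: taylor2_id|exact: taylor2_cst].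
  by apply: taylor2V; rewrite subr_eq0.
have gA : Re (g z) = normc A ^+ 2.
  rewrite /g -/A sqr_normcE cReM; case: (A) => a b /=; ring.
have nconj : normc (conjc A) = normc A by case: (A) => a b /=; rewrite sqrrN.
have := max_principle_Re r0 tg (B := normc A * (M / r ^+ n)) _ zin.
rewrite gA => /(_ _)/wrap[].
  move=> w win /square_boundary rw; apply: le_trans (ler_norm _) _.
  apply: le_trans (Re_le_normc _) _; rewrite /g normcM nconj.
  rewrite ler_wpM2l ?normc_ge0// normcM normcX normcV ler_pM ?normc_ge0 ?exprn_ge0 ?invr_ge0 ?normc_ge0//.
    exact: cmax.
  by rewrite exprVn lef_pV2 ?posrE ?exprn_gt0 ?(lt_le_trans r0)// lerXn2r// nnegrE ?normc_ge0 ?ltW.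
have nzp : 0 < normc (z - p) by rewrite normc_gt0.
have [->|fz] := eqVneq (f z) 0.
  by move=> _; rewrite normc0 mulr_ge0 ?normc_ge0 ?exprn_ge0 ?divr_ge0 ?normc_ge0 ?ltW.
have An : normc A = normc (f z) / normc (z - p) ^+ n.
  by rewrite normcM normcX normcV exprVn.
have A0 : 0 < normc A by rewrite An divr_gt0 ?exprn_gt0// normc_gt0.
rewrite expr2 ler_pM2l// An ler_pdivrMr ?exprn_gt0//.
by rewrite expr_div_n mulrAC -mulrA.
Qed.

End MaximumPrinciple.

(** * Resolvent kernels and the Cauchy transform *)
Section Resolvent.
Variable R : realType.
Local Notation C := R[i].
Implicit Types (z w h p c : C) (t x : R) (k : R -> R).

Definition resolvent w t : C := (w - t%:C)^-1.

Lemma normc_resolvent_le w t : 0 < Im w -> normc (resolvent w t) <= (Im w)^-1.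
Proof.
move=> w0; rewrite normcV lef_pV2 ?posrE ?Im_le_normc_sub//.
by rewrite (lt_le_trans w0)// Im_le_normc_sub.
Qed.

Lemma cmeas_resolvent w : 0 < Im w -> cmeas (resolvent w).
Proof.
move=> w0; apply: cmeasV; first by move=> t; exact: subr_real_neq0.
by apply: cmeasB; [exact: cmeas_cst|exact: cmeas_id].
Qed.

Lemma Im_resolvent w t :
  Im (resolvent w t) = - Im w / normc (w - t%:C) ^+ 2.
Proof. by rewrite /resolvent cImV sqr_normcE cReB cImB /= subr0. Qed.

Definition kernel_bound w : R := (1 + Im w + normc w) / Im w.

Lemma kernel_bound_ge0 w : 0 < Im w -> 0 <= kernel_bound w.
Proof. by move=> w0; rewrite divr_ge0 ?addr_ge0 ?normc_ge0 ?(ltW w0). Qed.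

(** The product of two such kernels is therefore dominated by
    [min 1 t^2], the integrable weight of a Levy measure. *)
Lemma normc_tresolvent_le w t : 0 < Im w ->
  normc (t%:C * resolvent w t) <= kernel_bound w * Num.min 1 `|t|.
Proof.
move=> w0; have nwt : 0 < normc (w - t%:C).
  by rewrite normc_gt0 subr_real_neq0.
rewrite normcM normcV normc_real ler_pdivrMr//.
have h1 : Im w <= normc (w - t%:C) by exact: Im_le_normc_sub.
have h2 : `|t| <= normc w + normc (w - t%:C).
  by rewrite -normc_real; have := normcB w (w - t%:C); rewrite subKr.
rewrite [X in _ <= X](_ : _ =
  (1 + Im w + normc w) * Num.min 1 `|t| * normc (w - t%:C) / Im w); last first.
  by rewrite /kernel_bound; field; rewrite gt_eqF.
rewrite ler_pdivlMr//.
have n0 := normc_ge0 w; have t0 : 0 <= `|t| by [].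
case: (leP 1 `|t|) => ht; rewrite ?(min_idPl ht) ?mulr1.
  nra.
have h3 : 0 <= `|t| * (normc (w - t%:C) - Im w) by rewrite mulr_ge0// subr_ge0.
have h4 : 0 <= `|t| * normc (w - t%:C) * (Im w + normc w).
  by rewrite !mulr_ge0 ?addr_ge0// ltW.
lra.
Qed.

Lemma cauchy_kernel_expansion w h t : 0 < Im w -> 0 < Im (w + h) ->
  resolvent (w + h) t = resolvent w t - h * resolvent w t ^+ 2
    + h ^+ 2 * resolvent w t ^+ 3
    - h ^+ 3 * (resolvent w t ^+ 3 * resolvent (w + h) t).
Proof.
move=> w0 wh0; rewrite /resolvent; field.
by rewrite !subr_real_neq0.
Qed.

(** The remainder of the geometric expansion is [h^3] times an integral that
    stays bounded as long as [w + h] stays away from the real line. *)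
Lemma taylor2_stieltjes (m : measR R) (f : R -> R) k w : 0 < Im w ->
  measurable_fun (setT : set (measurableTypeR R)) f ->
  rint m k -> (forall t, `|f t| <= k t) ->
  taylor2 (fun w => cintegral m (fun t => (f t)%:C * resolvent w t)) w.
Proof.
move=> w0 mf ik fk.
have mfC : cmeas (fun t => (f t)%:C) by exact: cmeas_real.
have cI n : cint m (fun t => (f t)%:C * resolvent w t ^+ n).
  have mr : cmeas (fun t => resolvent w t ^+ n).
    elim: n => [|n IH]; first by under eq_fun do rewrite expr0; exact: cmeas_cst.
    by under eq_fun do rewrite exprS; apply: cmeasM => //; exact: cmeas_resolvent.
  apply: (@cint_dom _ m _ (fun t => (Im w)^-1 ^+ n * k t)); first exact: cmeasM.
    exact: rintZ.
  move=> t; rewrite normcM normc_real mulrC normcX.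
  by rewrite ler_pM ?exprn_ge0 ?normc_ge0// lerXn2r ?nnegrE ?normc_ge0 ?invr_ge0 ?normc_resolvent_le// ltW.
pose I n := cintegral m (fun t => (f t)%:C * resolvent w t ^+ n).
exists (- I 2%N), (I 3%N).
pose rho h := cintegral m (fun t => (f t)%:C * resolvent w t ^+ 3 * resolvent (w + h) t).
pose K := (Im w)^-1 ^+ 3 * (Im w / 2)^-1.
have K0 : 0 <= K by rewrite mulr_ge0 ?exprn_ge0 ?invr_ge0 ?divr_ge0 ?(ltW w0).
have imwh h : normc h < Im w / 2 -> Im w / 2 <= Im (w + h).
  move=> hd; have := Im_le_normc h; rewrite ler_norml cImD => /andP[+ _]; lra.
have bnd h t : normc h < Im w / 2 ->
    normc ((f t)%:C * resolvent w t ^+ 3 * resolvent (w + h) t) <= K * k t.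
  move=> hd; have wh := imwh h hd.
  rewrite -mulrA [_%:C * _]mulrC normcM normc_real ler_pM ?normc_ge0//.
  rewrite normcM normcX ler_pM ?exprn_ge0 ?normc_ge0//.
    by rewrite lerXn2r ?nnegrE ?normc_ge0 ?invr_ge0 ?normc_resolvent_le// ltW.
  apply: le_trans (normc_resolvent_le _ _) _; first by rewrite (lt_le_trans _ wh)// divr_gt0.
  by rewrite lef_pV2 ?posrE ?(lt_le_trans _ wh) ?divr_gt0.
have cR h : normc h < Im w / 2 ->
    cint m (fun t => (f t)%:C * resolvent w t ^+ 3 * resolvent (w + h) t).
  move=> hd; apply: (@cint_dom _ m _ (fun t => K * k t)); last by move=> t; exact: bnd.
    apply: cmeasM.
      apply: cmeasM => //; under eq_fun do rewrite !exprS expr0.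
      do 3! (apply: cmeasM; first exact: cmeas_resolvent).
      exact: cmeas_cst.
    by apply: cmeas_resolvent; rewrite (lt_le_trans _ (imwh _ hd)) ?divr_gt0.
  exact: rintZ.
have Rle h : normc h < Im w / 2 -> normc (rho h) <= 2 * Rintegral m setT (fun t => K * k t).
  move=> hd; apply: normc_cintegral; last by move=> t; exact: bnd.
    exact: cint_cmeas (cR h hd).
  exact: rintZ.
exists (2 * Rintegral m setT (fun t => K * k t)), (Im w / 2); split.
- rewrite mulr_ge0// Rintegral_ge0// => t _; rewrite mulr_ge0//.
  by rewrite (le_trans _ (fk t)).
- by rewrite divr_gt0.
move=> h hd; have wh0 : 0 < Im (w + h) by rewrite (lt_le_trans _ (imwh _ hd)) ?divr_gt0.
rewrite (_ : _ - _ = - (h ^+ 3 * rho h)); last first.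
  under eq_fun do rewrite (cauchy_kernel_expansion _ w0 wh0).
  rewrite (_ : (fun t => _) = (fun t => (f t)%:C * resolvent w t ^+ 1
      + (- h) * ((f t)%:C * resolvent w t ^+ 2)
      + h ^+ 2 * ((f t)%:C * resolvent w t ^+ 3)
      + (- h ^+ 3) * ((f t)%:C * resolvent w t ^+ 3 * resolvent (w + h) t))); last first.
    by apply/funext => t; ring.
  have i1 := cintD (cI 1%N) (cintZ (- h) (cI 2%N)).
  have i2 := cintD i1 (cintZ (h ^+ 2) (cI 3%N)).
  rewrite !cintegralD ?cintegralZ//; try (exact: cR || exact: cintZ (cR _ hd)|| exact: cintZ).
  rewrite -/(I 2%N) -/(I 3%N) -/(rho h); under eq_fun do rewrite expr1.
  ring.
by rewrite normc_opp normcM normcX mulrC ler_wpM2r ?exprn_ge0 ?normc_ge0// Rle.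
Qed.

Lemma Rintegral_gt0 (m : measR R) k (A : set R) :
  measurable (A : set (measurableTypeR R)) -> m A != 0%E ->
  rint m k -> (forall t, 0 <= k t) -> (forall t, A t -> 0 < k t) ->
  0 < Rintegral m setT k.
Proof.
move=> mA mA0 ik k0 kA; rewrite lt_def Rintegral_ge0 ?andbT//.
apply/eqP => I0; move/eqP: mA0; apply.
have : (\int[m]_t `|(k t)%:E| = 0)%E.
  rewrite -[RHS]/(0%:E) -I0 /Rintegral fineK; last exact: (integrable_fin_num _ ik).
  by apply: eq_integral => t _ /=; rewrite ger0_norm.
move/(ae_eq_integral_abs m measurableT (measurable_int _ ik)) => -[N [mN N0 subN]].
apply/eqP; rewrite eq_le measure_ge0 andbT -N0 le_measure ?inE//.
by move=> t /kA kt; apply: subN => /= /(_ I) [] /eqP; rewrite gt_eqF.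
Qed.

(** In fact
    [2 Re (1 / ((w - t) (w' - t))) = 1 / |w - t|^2 + 1 / |w' - t|^2
      - |w - conj w'|^2 / (|w - t|^2 |w' - t|^2)],
    and [|w - w'| <= |w - conj w'|] in the upper half-plane.  The last term is
    the source of the regularity of the reciprocal Cauchy transform. *)
Lemma Re_resolventM_le w w' t (B : R) : 0 < Im w -> 0 < Im w' -> 0 < B ->
  normc w <= B -> normc w' <= B ->
  Re (resolvent w t * resolvent w' t) <=
  (normc (resolvent w t) ^+ 2 + normc (resolvent w' t) ^+ 2) / 2
  - normc (w - w') ^+ 2 / 2 * (B + `|t|)^-1 ^+ 4.
Proof.
move=> w0 w0' B0 wB w'B.
have low u : 0 < Im u -> normc u <= B -> (B + `|t|)^-1 ^+ 2 <= normc (resolvent u t) ^+ 2.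
  move=> u0 uB; have n0 : 0 < normc (u - t%:C) by rewrite normc_gt0 subr_real_neq0.
  have Bt : 0 < B + `|t| by rewrite ltr_wpDr.
  rewrite lerXn2r ?nnegrE ?normc_ge0 ?invr_ge0 ?(ltW Bt)// normcV.
  rewrite lef_pV2 ?posrE//; apply: le_trans (normcB _ _) _.
  by rewrite normc_real lerD2r.
have h1 := low _ w0 wB; have h2 := low _ w0' w'B.
set b := (B + `|t|)^-1 in h1 h2 *.
have h3 : b ^+ 4 <= normc (resolvent w t) ^+ 2 * normc (resolvent w' t) ^+ 2.
  by rewrite (_ : 4 = 2 + 2)%N// exprD ler_pM ?sqr_ge0.
apply: (@le_trans _ _ ((normc (resolvent w t) ^+ 2 + normc (resolvent w' t) ^+ 2) / 2
  - normc (w - w') ^+ 2 / 2 * (normc (resolvent w t) ^+ 2 * normc (resolvent w' t) ^+ 2))).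
  rewrite !normcV !exprVn cReM !cReV !cImV -!sqr_normcE.
  have n1 : 0 < normc (w - t%:C) ^+ 2 by rewrite exprn_gt0// normc_gt0 subr_real_neq0.
  have n2 : 0 < normc (w' - t%:C) ^+ 2 by rewrite exprn_gt0// normc_gt0 subr_real_neq0.
  rewrite -subr_ge0 !(sqr_normcE, cReB, cImB) /= !subr0.
  rewrite sqr_normcE cReB cImB /= subr0 in n1; rewrite sqr_normcE cReB cImB /= subr0 in n2.
  rewrite (_ : _ - _ = (2 * Im w * Im w') /
    (((Re w - t) ^+ 2 + Im w ^+ 2) * ((Re w' - t) ^+ 2 + Im w' ^+ 2))).
    by rewrite divr_ge0 ?mulr_ge0 ?(ltW w0) ?(ltW w0')// ?(ltW n1) ?(ltW n2).
  by field; rewrite !gt_eqF.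
by rewrite lerD2l lerN2 ler_wpM2l// divr_ge0// sqr_ge0.
Qed.

End Resolvent.

(** * The inverse function given by the Levy-Khintchine representation *)
Section LevyKhintchine.
Variables (R : realType) (eta a : R) (nu : measR R).
Hypothesis a0 : 0 <= a.
Hypothesis nu_levy : (\int[nu]_t (Num.min 1 (t ^+ 2))%:E < +oo)%E.
Local Notation C := R[i].
Implicit Types (z w h p c : C) (t x : R).
Local Notation H := (right_inverse_ext eta a nu).
Local Notation cutoff t := (\1_(`[-1, 1] : set R) t : R).

Definition levy_weight t : R := Num.min 1 (t ^+ 2).

Lemma levy_weight_ge0 t : 0 <= levy_weight t.
Proof. by rewrite le_min ler01 sqr_ge0. Qed.

Lemma levy_weightE t : levy_weight t = Num.min 1 `|t| ^+ 2.
Proof.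
rewrite /levy_weight; case: (leP 1 `|t|) => ht.
  by rewrite expr1n; apply/min_idPl; rewrite -real_normK ?num_real// expr_ge1.
rewrite real_normK ?num_real//; apply/min_idPr.
by rewrite -real_normK ?num_real// exprn_ile1// ltW.
Qed.

Lemma rint_levy_weight : rint nu levy_weight.
Proof.
apply/integrableP; split.
  apply/measurable_EFinP; exact: measurable_minr.
apply: le_lt_trans nu_levy; rewrite le_eqVlt; apply/orP; left; apply/eqP.
by apply: eq_integral => t _ /=; rewrite ger0_norm// levy_weight_ge0.
Qed.

Definition levy_kernel w t : C :=
  w * t%:C * resolvent w t - t%:C * (cutoff t)%:C.

Lemma cutoffE t : cutoff t = (`|t|%R <= 1 :> R)%:R :> R.
Proof. by rewrite indicE mem_setE /= in_itv /= ler_norml. Qed.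

Lemma cmeas_cutoff : cmeas (fun t => (cutoff t)%:C).
Proof. exact/cmeas_real/measurable_indic. Qed.

Lemma cmeas_levy_kernel w : 0 < Im w -> cmeas (levy_kernel w).
Proof.
move=> w0; apply: cmeasB; last by apply: cmeasM; [exact: cmeas_id|exact: cmeas_cutoff].
apply: cmeasM; last exact: cmeas_resolvent.
by apply: cmeasM; [exact: cmeas_cst|exact: cmeas_id].
Qed.

Lemma normc_levy_kernel_le w t : 0 < Im w ->
  normc (levy_kernel w t) <= ((Im w)^-1 + normc w * kernel_bound w) * levy_weight t.
Proof.
move=> w0; rewrite levy_weightE /levy_kernel cutoffE mulrDl.
have iw0 : 0 <= (Im w)^-1 by rewrite invr_ge0 ltW.
have k0 := kernel_bound_ge0 w0; have n0 := normc_ge0 w.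
case: (leP `|t| 1) => ht.
  rewrite real_normK ?num_real//.
  rewrite (_ : _ - _ = (t ^+ 2)%:C * resolvent w t); last first.
    rewrite rmorphXn/= mulr1 /resolvent; field; exact: subr_real_neq0.
  apply: (@le_trans _ _ ((Im w)^-1 * t ^+ 2)); last first.
    by rewrite lerDl mulr_ge0 ?sqr_ge0// mulr_ge0.
  rewrite normcM normc_real ger0_norm ?sqr_ge0// mulrC ler_wpM2r ?sqr_ge0//.
  exact: normc_resolvent_le.
rewrite expr1n !mulr1 mulr0 subr0 -mulrA normcM.
apply: ler_wpDl => //; rewrite ler_wpM2l//.
by have := normc_tresolvent_le t w0; rewrite (min_idPl (ltW ht)) mulr1.
Qed.

Lemma cint_levy_kernel w : 0 < Im w -> cint nu (levy_kernel w).
Proof.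
move=> w0; apply: (cint_dom (cmeas_levy_kernel w0)
  (rintZ ((Im w)^-1 + normc w * kernel_bound w) rint_levy_weight)).
by move=> t; exact: normc_levy_kernel_le.
Qed.

Lemma levy_khintchineE w : 0 < Im w ->
  w * levy_khintchine eta a nu w^-1 = eta%:C + a%:C / w + cintegral nu (levy_kernel w).
Proof.
move=> w0; have wn0 := Im_gt0_neq0 w0.
rewrite /levy_khintchine !mulrDr -cintegralZ; last first.
  rewrite (_ : (fun t => _) = fun t => w^-1 * levy_kernel w t).
    exact/cintZ/cint_levy_kernel.
  apply/funext => t; rewrite /levy_kernel /resolvent.
  have e : 1 - t%:C * w^-1 = (w - t%:C) / w by field.
  by rewrite e; field; rewrite wn0 subr_real_neq0.
congr (_ + _ + _); [by field|by field|congr cintegral].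
apply/funext => t; rewrite /levy_kernel /resolvent.
have e : 1 - t%:C * w^-1 = (w - t%:C) / w by field.
by rewrite e; field; rewrite wn0 subr_real_neq0.
Qed.

Lemma right_inverse_extE w : 0 < Im w ->
  H w = w + eta%:C + a%:C / w + cintegral nu (levy_kernel w).
Proof.
by move=> w0; rewrite /right_inverse_ext levy_khintchineE// !addrA.
Qed.

Definition levy_coupling w w' : C := cintegral nu
  (fun t => (t%:C * resolvent w t) * (t%:C * resolvent w' t)).

Lemma normc_levy_coupling_le w w' t : 0 < Im w -> 0 < Im w' ->
  normc ((t%:C * resolvent w t) * (t%:C * resolvent w' t)) <=
  kernel_bound w * kernel_bound w' * levy_weight t.
Proof.
move=> w0 w0'; rewrite levy_weightE expr2 normcM [X in _ <= X]mulrACA.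
by rewrite ler_pM ?normc_ge0// normc_tresolvent_le.
Qed.

Lemma cmeas_tresolvent w : 0 < Im w -> cmeas (fun t => t%:C * resolvent w t).
Proof. by move=> w0; apply: cmeasM; [exact: cmeas_id|exact: cmeas_resolvent]. Qed.

Lemma cint_levy_coupling w w' : 0 < Im w -> 0 < Im w' ->
  cint nu (fun t => (t%:C * resolvent w t) * (t%:C * resolvent w' t)).
Proof.
move=> w0 w0'; apply: (cint_dom _
  (rintZ (kernel_bound w * kernel_bound w') rint_levy_weight)).
  by apply: cmeasM; exact: cmeas_tresolvent.
by move=> t; exact: normc_levy_coupling_le.
Qed.

(** This identity carries everything below: [1 - E w w'] is controlled from
    below by energies, without differentiating [H]. *)
Lemma right_inverse_ext_increment w w' : 0 < Im w -> 0 < Im w' ->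
  H w - H w' = (w - w') * (1 - a%:C / (w * w') - levy_coupling w w').
Proof.
move=> w0 w0'; rewrite !right_inverse_extE//.
have -> : cintegral nu (levy_kernel w) =
    cintegral nu (levy_kernel w') - (w - w') * levy_coupling w w'.
  rewrite /levy_coupling -cintegralZ; last exact: cint_levy_coupling.
  rewrite -cintegralB; [|exact: cint_levy_kernel|exact/cintZ/cint_levy_coupling].
  congr cintegral; apply/funext => t; rewrite /levy_kernel /resolvent; field.
  by rewrite !subr_real_neq0.
by field; rewrite !Im_gt0_neq0.
Qed.

(** The formula [Im (H w) = Im w * (1 - levy_energy w)] below makes
    [levy_energy w < 1] the condition for [H w] to lie in the upper
    half-plane. *)
Definition levy_energy w : R :=
  a / normc w ^+ 2 + Rintegral nu setT (fun t => normc (t%:C * resolvent w t) ^+ 2).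

Lemma rint_levy_energy w : 0 < Im w ->
  rint nu (fun t => normc (t%:C * resolvent w t) ^+ 2).
Proof.
move=> w0; have [h1 h2] := cmeas_tresolvent w0.
apply: (rint_le _ (rintZ (kernel_bound w * kernel_bound w) rint_levy_weight)).
  under eq_fun do rewrite sqr_normcE.
  by apply: measurable_funD; exact: measurable_funX.
move=> t; rewrite ger0_norm ?exprn_ge0 ?normc_ge0//.
by rewrite expr2 -normcM normc_levy_coupling_le.
Qed.

Lemma levy_energy_ge0 w : 0 < Im w -> 0 <= levy_energy w.
Proof.
move=> w0; rewrite addr_ge0 ?divr_ge0 ?exprn_ge0 ?normc_ge0//.
by apply: Rintegral_ge0 => t _; rewrite exprn_ge0 ?normc_ge0.
Qed.

Lemma Im_levy_kernel w t : 0 < Im w ->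
  Im (levy_kernel w t) = - Im w * normc (t%:C * resolvent w t) ^+ 2.
Proof.
move=> w0; rewrite normcM normcV exprMn exprVn normc_real.
rewrite real_normK ?num_real// /levy_kernel /resolvent cImB !cImM cReM cReV cImV.
rewrite -sqr_normcE cReB cImB /=.
have : normc (w - t%:C) ^+ 2 != 0 by rewrite expf_eq0/= normc_eq0 subr_real_neq0.
move: (cutoff t) (_ ^+ 2) => u N N0; by field.
Qed.

Lemma Im_right_inverse_ext w : 0 < Im w -> Im (H w) = Im w * (1 - levy_energy w).
Proof.
move=> w0; rewrite right_inverse_extE// !cImD /= addr0.
have -> : Im (a%:C / w) = - Im w * (a / normc w ^+ 2).
  by rewrite cImM cImV sqr_normcE /= mul0r addr0; field; rewrite -sqr_normcE expf_eq0/= normc_eq0 Im_gt0_neq0.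
have -> : Rintegral nu setT (fun t => Im (levy_kernel w t)) =
    - Im w * Rintegral nu setT (fun t => normc (t%:C * resolvent w t) ^+ 2).
  rewrite -RintegralZl//; last exact: rint_levy_energy.
  by apply: eq_Rintegral => t _; exact: Im_levy_kernel.
rewrite /levy_energy; ring.
Qed.

Lemma levy_energy_Im w : 0 < Im w -> levy_energy w = 1 - Im (H w) / Im w.
Proof.
by move=> w0; rewrite Im_right_inverse_ext//; field; rewrite gt_eqF.
Qed.

(** The kernel [w t / (w - t)] is not an integrable multiple of a resolvent,
    but [t^2 / (1 + t^2) * ((1 + w^2) / (w - t) - w) + t / (1 + t^2)] is an
    equivalent expression, which reduces the claim to [taylor2_stieltjes]. *)
Lemma taylor2_right_inverse_ext w : 0 < Im w -> taylor2 H w.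
Proof.
move=> w0.
pose f t := t ^+ 2 / (1 + t ^+ 2); pose g t := t / (1 + t ^+ 2) - t * cutoff t.
have d0 t : 0 < 1 + t ^+ 2 by rewrite ltr_pwDl// sqr_ge0.
have dC0 t : 1 + t%:C ^+ 2 != 0 :> C.
  by rewrite -[1]/(1%:C) -rmorphXn -rmorphD/= fmorph_eq0 gt_eqF.
have mf : measurable_fun (setT : set (measurableTypeR R)) f.
  apply: measurable_funM; first exact: measurable_funX.
  apply: measurable_funV_ge0; first by move=> t; exact: ltW.
  by apply: measurable_funD => //; exact: measurable_funX.
have mg : measurable_fun (setT : set (measurableTypeR R)) g.
  apply: measurable_funB; apply: measurable_funM => //.
    apply: measurable_funV_ge0; first by move=> t; exact: ltW.
    by apply: measurable_funD => //; exact: measurable_funX.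
have fk t : `|f t| <= levy_weight t.
  have f0 : 0 <= f t by rewrite divr_ge0 ?sqr_ge0// ltW.
  rewrite ger0_norm// /f /levy_weight le_min !ler_pdivrMr// mul1r lerDr ler01.
  by rewrite ler_peMr ?sqr_ge0// lerDl sqr_ge0.
have gk t : `|g t| <= levy_weight t.
  rewrite levy_weightE /g cutoffE; case: (leP `|t| 1) => ht.
    rewrite mulr1 (_ : _ - t = - (t ^+ 2 * (t / (1 + t ^+ 2)))); last by field; rewrite gt_eqF.
    rewrite normrN normrM ger0_norm ?sqr_ge0// real_normK ?num_real//.
    rewrite ler_piMr ?sqr_ge0// normrM normfV (ger0_norm (ltW (d0 t))).
    by rewrite ler_pdivrMr// mul1r (le_trans ht)// lerDl sqr_ge0.
  rewrite mulr0 subr0 expr1n normrM normfV (ger0_norm (ltW (d0 t))).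
  rewrite ler_pdivrMr// mul1r -[t ^+ 2]real_normK ?num_real//.
  rewrite -[X in X <= _]mulr1 expr2; nra.
have if_ : rint nu f by exact: rint_le mf rint_levy_weight fk.
have ig : rint nu g by exact: rint_le mg rint_levy_weight gk.
pose S w := cintegral nu (fun t => (f t)%:C * resolvent w t).
have HE z : 0 < Im z -> H z = z + eta%:C + a%:C * z^-1 +
    ((1 + z * z) * S z + (- z) * (Rintegral nu setT f)%:C + (Rintegral nu setT g)%:C).
  move=> z0; rewrite right_inverse_extE//; congr (_ + _).
  have i1 : cint nu (fun t => (f t)%:C * resolvent z t).
    apply: (cint_dom _ (rintZ (Im z)^-1 rint_levy_weight)).
      by apply: cmeasM; [exact: cmeas_real|exact: cmeas_resolvent].
    move=> t; rewrite mulrC normcM normc_real ler_pM ?normc_ge0//.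
    exact: normc_resolvent_le.
  have i2 : cint nu (fun t => (f t)%:C).
    apply: (cint_dom (cmeas_real mf) rint_levy_weight) => t.
    by rewrite normc_real.
  have i3 : cint nu (fun t => (g t)%:C).
    apply: (cint_dom (cmeas_real mg) rint_levy_weight) => t.
    by rewrite normc_real.
  rewrite -!cintegral_real /S.
  rewrite -!cintegralZ// -!cintegralD//; try by do ?apply: cintD; apply: cintZ.
  congr cintegral; apply/funext => t; rewrite /levy_kernel.
  have -> : (f t)%:C = t%:C ^+ 2 / (1 + t%:C ^+ 2).
    by rewrite /f rmorphM/= fmorphV/= rmorphD/= !rmorphXn.
  have -> : (g t)%:C = t%:C / (1 + t%:C ^+ 2) - t%:C * (cutoff t)%:C.
    by rewrite /g rmorphB/= !rmorphM/= fmorphV/= rmorphD/= !rmorphXn.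
  by rewrite /resolvent; field; rewrite dC0 subr_real_neq0.
apply: (@taylor2_local _ (fun z => z + eta%:C + a%:C * z^-1 +
    ((1 + z * z) * S z + (- z) * (Rintegral nu setT f)%:C + (Rintegral nu setT g)%:C)) _ _ (Im w)) => //.
  move=> h hw; rewrite HE// cImD.
  by have := Im_le_normc h; rewrite ler_norml => /andP[+ _]; lra.
have tS : taylor2 S w by exact: (taylor2_stieltjes w0 mf rint_levy_weight fk).
have tV := taylor2V (Im_gt0_neq0 w0).
have tid := taylor2_id w; have tc := fun c => taylor2_cst c w.
apply: taylor2D; [apply: taylor2D|apply: taylor2D]; [exact: taylor2D| |apply: taylor2D|exact: tc].
- exact: taylor2M.
- by apply: taylor2M => //; apply: taylor2D => //; exact: taylor2M.
- by apply: taylor2M => //; exact: taylor2N.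
Qed.

End LevyKhintchine.

(** * The reciprocal Cauchy transform *)
Section RecipCauchy.
Variables (R : realType) (mu : probR R).
Local Notation C := R[i].
Implicit Types (z w h p c : C) (t x : R).
Local Notation G := (cauchy_transform mu).
Local Notation F := (recip_cauchy mu).

Lemma rint_prob_cst (c : R) : rint mu (fun=> c).
Proof. exact: finite_measure_integrable_cst. Qed.

Lemma Rintegral_prob_cst (c : R) : Rintegral mu setT (fun=> c) = c.
Proof.
rewrite Rintegral_cst//.
rewrite -[RHS]mulr1; congr (_ * _).
exact: (congr1 fine (probability_setT mu)).
Qed.

Lemma cint_resolvent z : 0 < Im z -> cint mu (resolvent z).
Proof.
move=> z0; apply: (cint_dom (cmeas_resolvent z0) (rint_prob_cst (Im z)^-1)) => t.
exact: normc_resolvent_le.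
Qed.

Lemma taylor2_cauchy_transform z : 0 < Im z -> taylor2 G z.
Proof.
move=> z0; have := @taylor2_stieltjes R mu (fun=> 1) (fun=> 1) z z0.
have -> : (fun w => cintegral mu (fun t => 1%:C * resolvent w t)) = G.
  by apply/funext => w; congr cintegral; apply/funext => t; rewrite mul1r.
apply; [exact: measurable_cst|exact: rint_prob_cst|by move=> t; rewrite normr1].
Qed.

Lemma rint_sqr_resolvent z : 0 < Im z -> rint mu (fun t => normc (resolvent z t) ^+ 2).
Proof.
move=> z0; have [m1 m2] := cmeas_resolvent z0.
apply: (rint_le _ (rint_prob_cst ((Im z)^-1 ^+ 2))).
  under eq_fun do rewrite sqr_normcE.
  by apply: measurable_funD; exact: measurable_funX.
move=> t; rewrite ger0_norm ?exprn_ge0 ?normc_ge0//.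
by rewrite lerXn2r ?nnegrE ?normc_ge0 ?invr_ge0 ?normc_resolvent_le// ltW.
Qed.

Lemma Im_cauchy_transform z : 0 < Im z ->
  Im (G z) = - Im z * Rintegral mu setT (fun t => normc (resolvent z t) ^+ 2).
Proof.
move=> z0; rewrite -RintegralZl//; last exact: rint_sqr_resolvent.
apply: eq_Rintegral => t _.
by rewrite [LHS]Im_resolvent /resolvent normcV exprVn.
Qed.

Lemma Im_cauchy_transform_lt0 z : 0 < Im z -> Im (G z) < 0.
Proof.
move=> z0; rewrite Im_cauchy_transform// mulNr oppr_lt0 mulr_gt0//.
apply: (@Rintegral_gt0 _ _ _ setT) => //.
- by rewrite (_ : _ setT = 1%E)//; exact: probability_setT.
- exact: rint_sqr_resolvent.
- by move=> t; rewrite exprn_ge0 ?normc_ge0.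
- by move=> t _; rewrite exprn_gt0// normc_gt0 invr_eq0 subr_real_neq0.
Qed.

Lemma cauchy_transform_neq0 z : 0 < Im z -> G z != 0.
Proof.
move=> /Im_cauchy_transform_lt0 h; apply/eqP => e.
by rewrite e ltxx in h.
Qed.

Lemma Im_recip_cauchy z : Im (F z) = - Im (G z) / normc (G z) ^+ 2.
Proof. by rewrite cImV sqr_normcE. Qed.

Lemma Im_recip_cauchy_gt0 z : 0 < Im z -> 0 < Im (F z).
Proof.
move=> z0; rewrite Im_recip_cauchy divr_gt0 ?oppr_gt0 ?Im_cauchy_transform_lt0//.
by rewrite exprn_gt0 ?normc_gt0 ?cauchy_transform_neq0.
Qed.

Lemma taylor2_recip_cauchy z : 0 < Im z -> taylor2 F z.
Proof.
move=> z0; apply: (@taylor2_comp _ (fun z => z^-1)).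
  exact: taylor2_cauchy_transform.
by apply: taylor2V; exact: cauchy_transform_neq0.
Qed.

End RecipCauchy.

(** * Behaviour at infinity in truncated cones *)
Section TailWeight.
Variable R : realType.
Implicit Types (z w : R[i]) (t b : R).

(** A common majorant, on the cone of opening one above height [b], for the
    error terms [t / (z - t)]: bounded, and tending to [0] pointwise as [b]
    grows. *)
Definition tail_weight b t : R := Num.min 3 (Num.max 1 `|t| / b).

Lemma tail_weight_ge0 b t : 0 < b -> 0 <= tail_weight b t.
Proof. by move=> b0; rewrite le_min ler0n/= divr_ge0 ?(ltW b0)// le_max ler01. Qed.

Lemma tail_weight_le3 b t : tail_weight b t <= 3.
Proof. by rewrite ge_min lexx. Qed.

Lemma measurable_tail_weight b :
  measurable_fun (setT : set (measurableTypeR R)) (tail_weight b).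
Proof.
apply: measurable_minr => //; apply: measurable_funM => //.
apply: measurable_maxr => //; exact: measurableT_comp.
Qed.

Lemma rint_tail_weight (m : measR R) (k : R -> R) b : 0 < b ->
  rint m k -> (forall t, 0 <= k t) -> rint m (fun t => k t * tail_weight b t).
Proof.
move=> b0 ik k0; apply: (rint_le _ (rintZ 3 ik)).
  by apply: measurable_funM; [exact: rint_meas ik|exact: measurable_tail_weight].
move=> t; rewrite ger0_norm ?mulr_ge0 ?tail_weight_ge0// mulrC.
by rewrite ler_wpM2r// tail_weight_le3.
Qed.

Lemma tail_weight_small (m : measR R) (k : R -> R) (e B : R) :
  rint m k -> (forall t, 0 <= k t) -> 0 < e ->
  exists b, [/\ 0 < b, B < b & Rintegral m setT (fun t => k t * tail_weight b t) <= e].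
Proof.
move=> ik k0 e0.
have h : Rintegral m setT (fun t => k t * tail_weight n.+1%:R t) @[n --> \oo] -->
    Rintegral m setT (fun=> 0).
  apply: (@Rintegral_dominated_cvg _ _ _ _ (fun t => 3 * k t)).
  - by move=> n; exact: (rint_meas (rint_tail_weight (ltr0Sn _ n) ik k0)).
  - exact: rintZ.
  - move=> n t; rewrite ger0_norm ?mulr_ge0 ?tail_weight_ge0// mulrC.
    by rewrite ler_wpM2r// tail_weight_le3.
  - move=> t; apply: (@squeeze_cvgr _ _ _ _ (fun=> 0) (fun n => k t * (Num.max 1 `|t|) * harmonic n)).
    + apply: nearW => n; rewrite mulr_ge0 ?tail_weight_ge0//=.
      by rewrite -mulrA ler_wpM2l// /harmonic/= ge_min lexx orbT.
    + exact: cvg_cst.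
    + rewrite -[X in _ --> X](mulr0 (k t * Num.max 1 `|t|)).
      by apply: cvgMl_tmp; exact: cvg_harmonic.
rewrite [X in _ --> X](_ : _ = 0) in h; last by rewrite Rintegral_cst// mul0r.
have [N _ HN] := cvgr_le _ h _ e0.
pose n := maxn N (Num.truncn (Num.max 0 B)).
exists n.+1%:R; split => //; last by apply: HN => /=; rewrite leq_maxl.
apply: (@le_lt_trans _ _ (Num.max 0 B)); first by rewrite le_max lexx orbT.
have := real_truncnS_gt (num_real (Num.max 0 B)).
by move=> /lt_le_trans; apply; rewrite ler_nat ltnS leq_maxr.
Qed.

Lemma cone_Im_gt0 l b z : 0 < b -> trunc_cone l b z -> 0 < Im z.
Proof. by move=> b0 [h _]; exact: lt_trans h. Qed.

Lemma normc_cone_le l b z : trunc_cone l b z -> 0 < b -> normc z <= (1 + l) * Im z.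
Proof.
move=> [h1 h2] b0; apply: le_trans (normc_le z) _.
by rewrite (ger0_norm (ltW (lt_trans b0 h1))); lra.
Qed.

Lemma normc_tresolvent_tail b z t : 0 < b -> trunc_cone 1 b z ->
  normc (t%:C * resolvent z t) <= tail_weight b t.
Proof.
move=> b0 zc; have nz := normc_cone_le zc b0; case: zc => h1 h2.
have z0 : 0 < Im z by lra.
have h3 := Im_le_normc_sub z t.
have h4 : `|t| <= normc z + normc (z - t%:C).
  by rewrite -normc_real; have := normcB z (z - t%:C); rewrite subKr.
rewrite normcM normcV normc_real le_min; apply/andP; split.
  by rewrite ler_pdivrMr; lra.
apply: ler_pM; rewrite ?invr_ge0 ?normc_ge0//; first by rewrite le_max lexx orbT.
by rewrite lef_pV2 ?posrE; lra.
Qed.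

End TailWeight.

Section NearInfinity.
Variables (R : realType) (mu : probR R).
Local Notation C := R[i].
Implicit Types (z w v h p c : C) (t x : R).
Local Notation G := (cauchy_transform mu).
Local Notation F := (recip_cauchy mu).

Lemma cauchy_transform_increment z w : 0 < Im z -> 0 < Im w ->
  G z - G w = (w - z) * cintegral mu (fun t => resolvent z t * resolvent w t).
Proof.
move=> z0 w0; have iz := cint_resolvent mu z0; have iw := cint_resolvent mu w0.
rewrite -cintegralB// -cintegralZ; last first.
  have mzw := cmeasM (cmeas_resolvent z0) (cmeas_resolvent w0).
  apply: (cint_dom mzw (rint_prob_cst mu ((Im z)^-1 * (Im w)^-1))) => t.
  by rewrite normcM ler_pM ?normc_ge0 ?normc_resolvent_le.
congr cintegral; apply/funext => t; rewrite /resolvent; field.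
by rewrite !subr_real_neq0.
Qed.

(** With [g = z G z] and [I = int 1 / ((z - t) (w - t)) dmu], one has
    [F z = z / g] and [F z - F w = (z - w) I / (G z G w)]; both [g] and
    [z w I] tend to [1] in the cone because [z / (z - t) = 1 + t / (z - t)].
    The second bound makes [F] injective on the cone, the first one will force
    its range to contain a smaller cone. *)
Lemma recip_cauchy_near_id : exists2 b : R, 0 < b &
  forall z w, trunc_cone 1 b z -> trunc_cone 1 b w ->
    normc (F z - z) <= normc z / 40 /\
    normc (F z - F w - (z - w)) <= normc (z - w) / 2.
Proof.
(* a tail of [1 / 200] puts [g] within [1 / 100] and [z w I] within [1 / 20]
   of [1], which is enough for both bounds *)
have d0 : 0 < 200^-1 :> R by lra.
have [b [b0 _ tb]] := tail_weight_small 0 (rint_prob_cst mu 1) (fun=> ler01) d0.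
have itw : rint mu (tail_weight b).
  rewrite -[X in rint _ X](_ : (fun t => 1 * tail_weight b t) = _).
    exact: (rint_tail_weight b0 (rint_prob_cst mu 1) (fun=> ler01)).
  by apply/funext => t; rewrite mul1r.
rewrite (_ : (fun t => 1 * tail_weight b t) = tail_weight b) in tb; last first.
  by apply/funext => t; rewrite mul1r.
exists b => // z w zc wc.
have gE u : trunc_cone 1 b u -> normc (u * G u - 1) <= 100^-1.
  move=> uc; have u0 := cone_Im_gt0 b0 uc.
  have -> : u * G u - 1 = cintegral mu (fun t => t%:C * resolvent u t).
    rewrite -cintegralZ; last exact: cint_resolvent.
    have -> : (1 : C) = cintegral mu (fun t => 1%:C).
      by rewrite cintegral_real Rintegral_prob_cst.
    rewrite -cintegralB.
    - congr cintegral; apply/funext => t; rewrite /resolvent; field.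
      exact: subr_real_neq0.
    - exact/cintZ/cint_resolvent.
    - by split; exact: rint_prob_cst.
  apply: le_trans (@normc_cintegral _ mu _ (tail_weight b) _ itw _) _.
  - by apply: cmeasM; [exact: cmeas_id|exact: cmeas_resolvent].
  - by move=> t; exact: normc_tresolvent_tail.
  - lra.
have z0 := cone_Im_gt0 b0 zc; have w0 := cone_Im_gt0 b0 wc.
have gz := gE _ zc; have gw := gE _ wc.
have low u : normc (u * G u - 1) <= 100^-1 -> 99/100 <= normc (u * G u) <= 101/100.
  move=> h; have := normcBr 1 (1 - u * G u); rewrite subKr normc1 normcBC => h1.
  have := normcD (u * G u - 1) 1; rewrite subrK normc1; lra.
have /andP[lz uz] := low _ gz; have /andP[lw uw] := low _ gw.
have zn0 := Im_gt0_neq0 z0; have wn0 := Im_gt0_neq0 w0.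
have Gz0 := cauchy_transform_neq0 mu z0; have Gw0 := cauchy_transform_neq0 mu w0.
split.
  have -> : F z - z = z * ((1 - z * G z) / (z * G z)).
    by rewrite /recip_cauchy; field; rewrite zn0 Gz0.
  rewrite normcM ler_wpM2l ?normc_ge0// normcM normcV.
  rewrite ler_pdivrMr; last by lra.
  rewrite normcBC; lra.
pose I := cintegral mu (fun t => resolvent z t * resolvent w t).
have zw_cmeas : cmeas (fun t => resolvent z t * resolvent w t).
  by apply: cmeasM; exact: cmeas_resolvent.
have cI : cint mu (fun t => resolvent z t * resolvent w t).
  apply: (cint_dom zw_cmeas (rint_prob_cst mu ((Im z)^-1 * (Im w)^-1))) => t.
  by rewrite normcM ler_pM ?normc_ge0 ?normc_resolvent_le.
have kI : normc (z * w * I - 1) <= 20^-1.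
  have -> : z * w * I - 1 = cintegral mu (fun t => t%:C * resolvent z t +
      t%:C * resolvent w t + t%:C * resolvent z t * (t%:C * resolvent w t)).
    rewrite -cintegralZ//.
    have -> : (1 : C) = cintegral mu (fun t => 1%:C).
      by rewrite cintegral_real Rintegral_prob_cst.
    rewrite -cintegralB.
    - congr cintegral; apply/funext => t; rewrite /resolvent; field.
      by rewrite !subr_real_neq0.
    - exact: cintZ.
    - by split; exact: rint_prob_cst.
  have mt u : 0 < Im u -> cmeas (fun t => t%:C * resolvent u t).
    by move=> u0; apply: cmeasM; [exact: cmeas_id|exact: cmeas_resolvent].
  apply: le_trans (@normc_cintegral _ mu _ (fun t => 5 * tail_weight b t) _ (rintZ 5 itw) _) _.
  - by apply: cmeasD; [apply: cmeasD|apply: cmeasM]; exact: mt.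
  - move=> t; apply: le_trans (normcD _ _) _.
    have h1 := normc_tresolvent_tail t b0 zc; have h2 := normc_tresolvent_tail t b0 wc.
    have h3 := normcD (t%:C * resolvent z t) (t%:C * resolvent w t).
    have h4 := normc_ge0 (t%:C * resolvent z t).
    have h5 := normc_ge0 (t%:C * resolvent w t).
    have h6 := tail_weight_le3 b t.
    rewrite [X in _ + X]normcM.
    have : normc (t%:C * resolvent z t) * normc (t%:C * resolvent w t) <=
      3 * tail_weight b t by apply: ler_pM => //; exact: le_trans h6.
    lra.
  - rewrite RintegralZl//; lra.
have -> : F z - F w - (z - w) = (z - w) *
    ((z * w * I - 1 - (z * G z - 1) * (w * G w) - (w * G w - 1)) / ((z * G z) * (w * G w))).
  have -> : F z - F w = (z - w) * I / (G z * G w).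
    have := cauchy_transform_increment z0 w0; rewrite -/I => e.
    rewrite (_ : (z - w) * I = G w - G z); first by rewrite /recip_cauchy; field; rewrite Gz0 Gw0.
    by rewrite -(opprB (G z)) e; ring.
  by field; rewrite zn0 wn0 Gz0 Gw0.
rewrite normcM ler_wpM2l ?normc_ge0// normcM normcV ler_pdivrMr; last first.
  by rewrite normcM mulr_gt0; lra.
apply: le_trans (normcB _ _) _.
have h1 := normcB (z * w * I - 1) ((z * G z - 1) * (w * G w)).
have h2 : normc ((z * G z - 1) * (w * G w)) <= 100^-1 * (101 / 100).
  by rewrite normcM ler_pM ?normc_ge0.
have h3 : 99 / 100 * (99 / 100) <= normc (z * G z * (w * G w)).
  by rewrite normcM ler_pM//; lra.
lra.
Qed.

(** A minimum of [|F v - w|] over a square around [w] is attained inside, and it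
    cannot be positive, since moving [v] in the direction [w - F v] would
    decrease it. *)
Lemma recip_cauchy_onto b : 0 < b ->
  (forall z w, trunc_cone 1 b z -> trunc_cone 1 b w ->
    normc (F z - z) <= normc z / 40 /\
    normc (F z - F w - (z - w)) <= normc (z - w) / 2) ->
  trunc_cone (1 / 2) (2 * b) `<=` F @` trunc_cone 1 b.
Proof.
move=> b0 Fb w [w1 w2].
have w0 : 0 < Im w by lra.
(* the square of this half-side around [w] stays in the larger cone, and on its
   boundary [|F v - w|] is larger than at the centre *)
pose r := Im w / 8.
have r0 : 0 < r by rewrite divr_gt0.
have sc v : square w r v -> trunc_cone 1 b v.
  rewrite /square /= !ler_norml cReB cImB /r => -[/andP[h1 h2] /andP[h3 h4]].
  move: w2; rewrite /trunc_cone /= !ltr_norml => /andP[h5 h6].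
  by split; [lra|apply/andP; split; lra].
have scb v : square w r v -> normc (v - w) <= 2 * r.
  move=> [h1 h2]; apply: le_trans (normc_le _) _; lra.
have wc : trunc_cone 1 b w by apply: sc; rewrite /square /= subrr normr0; split; exact: ltW.
have [v vin vmax] : exists2 c, square w r c &
    forall z, square w r z -> - normc (F z - w) <= - normc (F c - w).
  apply: EVT_square; first exact: ltW.
  move=> z zin; apply: ccontinuousN.
  apply: (@taylor2_ccontinuous_normc _ (fun z => F z - w)).
  apply: taylor2D; last exact: taylor2_cst.
  by apply: taylor2_recip_cauchy; exact: cone_Im_gt0 (sc _ zin).
have vc := sc _ vin.
have nw : normc w <= 3 / 2 * Im w.
  have := normc_le w; rewrite (gtr0_norm w0); lra.
have vint : square_interior w r v.
  apply: contrapT => /square_boundary rv.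
  have win : square w r w by rewrite /square /= subrr normr0; split; exact: ltW.
  have := vmax _ win; have [h1 _] := Fb _ _ wc wc; have [h2 _] := Fb _ _ vc vc.
  have h3 := normcD (v - w) w; rewrite subrK in h3.
  have h4 := normcBr (v - w) (v - F v).
  rewrite (_ : v - w - (v - F v) = F v - w) in h4; last by ring.
  rewrite (normcBC v (F v)) in h4.
  by move: rv (scb _ vin); rewrite /r; lra.
exists v => //; apply/eqP; rewrite -subr_eq0; apply: contrapT => /negP e0.
pose e := w - F v; pose g := Num.min (r - `|Re (v - w)|) (r - `|Im (v - w)|).
have ne : 0 < normc e by rewrite normc_gt0 -oppr_eq0 opprB.
have g0 : 0 < g by case: vint => ? ?; rewrite lt_min !subr_gt0; apply/andP.
pose s := Num.min 1 (g / normc e).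
have s0 : 0 < s by rewrite lt_min ltr01 divr_gt0.
have s1 : s <= 1 by rewrite ge_min lexx.
have sg : s * normc e <= g.
  by rewrite -ler_pdivlMr// ge_min lexx orbT.
have nse : normc (s%:C * e) <= g by rewrite normcM normc_real gtr0_norm.
have uin : square w r (v + s%:C * e).
  have := nse; rewrite le_min => /andP[h1 h2]; rewrite /square /=.
  rewrite (_ : v + _ - w = v - w + s%:C * e); last by ring.
  rewrite cReD cImD; split; apply: le_trans (ler_normD _ _) _.
    by have := Re_le_normc (s%:C * e); lra.
  by have := Im_le_normc (s%:C * e); lra.
have := vmax _ uin; rewrite lerN2; apply/negP; rewrite -ltNge.
have [_] := Fb _ _ (sc _ uin) vc.
rewrite (_ : v + s%:C * e - v = s%:C * e); last by ring.
have e1 : F (v + s%:C * e) - w = (F (v + s%:C * e) - F v - s%:C * e) - (1 - s)%:C * e.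
  by rewrite /e rmorphB/=; ring.
rewrite e1 => h; apply: le_lt_trans (normcB _ _) _.
rewrite (normcBC (F v)) -/e.
have n1 : normc (s%:C * e) = s * normc e by rewrite normcM normc_real gtr0_norm.
have n2 : normc ((1 - s)%:C * e) = (1 - s) * normc e.
  by rewrite normcM normc_real ger0_norm// subr_ge0.
rewrite n2; rewrite n1 in h.
have : 0 < s * normc e by rewrite mulr_gt0.
lra.
Qed.

End NearInfinity.

(** * The Levy-Khintchine function inverts [F] on the upper half-plane *)
Section Subordination.
Variables (R : realType) (mu : probR R) (eta a : R) (nu : measR R).
Hypothesis a0 : 0 <= a.
Hypothesis nu_levy : (\int[nu]_t (Num.min 1 (t ^+ 2))%:E < +oo)%E.
Local Notation C := R[i].
Implicit Types (z w v h p c : C) (t x : R).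
Local Notation G := (cauchy_transform mu).
Local Notation F := (recip_cauchy mu).
Local Notation H := (right_inverse_ext eta a nu).

Lemma levy_kernel_near_infinity b w t : 1 <= b -> trunc_cone 1 b w ->
  normc (levy_kernel w t) <= normc w * (levy_weight t * tail_weight b t).
Proof.
move=> b1 wc; have b0 : 0 < b by lra.
have w0 := cone_Im_gt0 b0 wc; have wn0 := Im_gt0_neq0 w0.
have nw : 0 < normc w by rewrite normc_gt0.
rewrite levy_weightE /levy_kernel cutoffE; case: (leP `|t| 1) => ht; last first.
  rewrite expr1n mul1r mulr0 subr0 -mulrA normcM ler_wpM2l ?normc_ge0//.
  exact: normc_tresolvent_tail.
rewrite real_normK ?num_real//.
rewrite (_ : _ - _ = w * ((t ^+ 2)%:C * (w^-1 * resolvent w t))); last first.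
  rewrite rmorphXn/= mulr1 /resolvent; field.
  by rewrite wn0 subr_real_neq0.
rewrite normcM ler_wpM2l ?normc_ge0// normcM normc_real ger0_norm ?sqr_ge0//.
rewrite ler_wpM2l ?sqr_ge0//; case: wc => bw _.
have h : normc (w^-1 * resolvent w t) <= b^-1 * b^-1.
  rewrite normcM ler_pM ?normc_ge0//.
    rewrite normcV lef_pV2 ?posrE//; apply: le_trans (ltW bw) _.
    by apply: le_trans (ler_norm _) _; exact: Im_le_normc.
  apply: le_trans (normc_resolvent_le _ w0) _.
  by rewrite lef_pV2 ?posrE// ltW.
have b11 : b^-1 <= 1 by rewrite invf_le1.
have bv0 : 0 < b^-1 by rewrite invr_gt0.
apply: le_trans h _; rewrite le_min; apply/andP; split; first by nra.
have m1 : 1 <= Num.max 1 `|t| by rewrite le_max lexx.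
by nra.
Qed.

Lemma right_inverse_ext_near_id B : exists b, [/\ 0 < b, B < b &
  forall w, trunc_cone 1 b w -> normc (H w - w) <= normc w / 40].
Proof.
have d0 : 0 < 200^-1 :> R by lra.
have il := rint_levy_weight nu_levy.
have [b [b0 Bb tb]] := tail_weight_small
  (Num.max (Num.max 1 B) (Num.max (200 * `|eta|) (200 * a))) il (@levy_weight_ge0 R) d0.
move: Bb; rewrite !gt_max => /andP[/andP[b1 Bb] /andP[be ba]].
exists b; split => // w wc; have w0 := cone_Im_gt0 b0 wc.
have wn0 := Im_gt0_neq0 w0.
have bw : b <= normc w.
  case: wc => /ltW/le_trans + _; apply.
  by apply: le_trans (ler_norm _) _; exact: Im_le_normc.
rewrite right_inverse_extE//.
rewrite (_ : _ - w = eta%:C + a%:C / w + cintegral nu (levy_kernel w)); last by ring.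
apply: le_trans (normcD _ _) _; have := normcD eta%:C (a%:C / w).
have h1 : normc (cintegral nu (levy_kernel w)) <= normc w / 100.
  have itw := rint_tail_weight b0 il (@levy_weight_ge0 R).
  apply: le_trans (@normc_cintegral _ nu _ _ (cmeas_levy_kernel w0) (rintZ (normc w) itw) _) _.
    by move=> t; apply: levy_kernel_near_infinity => //; exact: ltW.
  rewrite RintegralZl// mulrCA ler_wpM2l ?normc_ge0//; lra.
have h2 : normc (a%:C / w) <= a.
  rewrite normcM normcV normc_real ger0_norm// ler_pdivrMr ?normc_gt0//.
  by rewrite ler_peMr//; lra.
rewrite normc_real; lra.
Qed.

Hypothesis triplet : forall z, right_inverse_dom mu z^-1 ->
  free_cumulant mu z = levy_khintchine eta a nu z.

(** For [w = F z] the right inverse of [F] at [w] is [H w], which lies in the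
    cone where [F] is injective because [H] too is close to the identity.  It
    has the same image [w] under [F] as [z], so it equals [z], whatever cones
    the right inverse was built from. *)
Lemma right_inverse_extK_near_infinity : exists Y0 : R, forall Y, Y0 <= Y ->
  forall z, normc (z - Y *i) < 1 -> H (F z) = z.
Proof.
have [b b0 Fb] := recip_cauchy_near_id mu.
have [b' [b'0 bb' Hb]] := right_inverse_ext_near_id (2 * b).
exists (10 + 2 * b') => Y YY z zY.
have := Re_le_normc (z - Y *i); have := Im_le_normc (z - Y *i).
rewrite cReB cImB /= !ler_norml => /andP[i1 i2] /andP[r1 r2].
have nz : normc z <= 2 * Im z.
  have := normc_le z; have : `|Re z| <= 1 by rewrite ler_norml; lra.
  rewrite (ger0_norm (_ : 0 <= Im z)); lra.
have zc : trunc_cone 1 b z by split; [lra|rewrite ltr_norml; lra].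
have [h1 _] := Fb _ _ zc zc.
have := Re_le_normc (F z - z); have := Im_le_normc (F z - z).
rewrite cReB cImB !ler_norml => /andP[i3 i4] /andP[r3 r4].
set w := F z in h1 i3 i4 r3 r4 *.
have wc2 : trunc_cone (1 / 2) (2 * b) w.
  by split; [lra|rewrite ltr_norml; lra].
have wc' : trunc_cone 1 b' w by split; [lra|rewrite ltr_norml; lra].
have rio : right_inverse_on mu (1 / 2) (2 * b) 1 b.
  split; first by split; lra.
  split; last exact: recip_cauchy_onto.
  move=> x y /set_mem xc /set_mem yc xy; have [_] := Fb _ _ xc yc.
  rewrite xy subrr add0r normc_opp => hxy.
  apply/eqP; rewrite -subr_eq0 -normc_eq0; apply/eqP.
  have := normc_ge0 (x - y); lra.
have wn0 : w != 0 by apply: Im_gt0_neq0; exact: cone_Im_gt0 b'0 wc'.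
have wdom : right_inverse_dom mu w.
  by exists z, (1 / 2), (2 * b), 1, b; split.
have := triplet (z := w^-1); rewrite /free_cumulant invrK => /(_ wdom) tw.
have vH : Defs.right_inverse mu w = H w.
  rewrite /right_inverse_ext -tw; field; exact: wn0.
have [v vrel] := wdom.
have /= := xgetPex 0 (ex_intro [set v | right_inverse_rel mu w v] v vrel).
rewrite -/(Defs.right_inverse mu w) vH => -[l [M [al [be [_ _ _ FH]]]]].
have h2 := Hb _ wc'.
have := Re_le_normc (H w - w); have := Im_le_normc (H w - w).
have nw : normc w <= 3 / 2 * Im w.
  have := normc_le w; case: wc2; rewrite ltr_norml => ? ?.
  have : `|Re w| <= 1 / 2 * Im w by rewrite ler_norml; lra.
  rewrite (ger0_norm (_ : 0 <= Im w)); lra.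
rewrite cReB cImB !ler_norml => /andP[i5 i6] /andP[r5 r6].
have Hc : trunc_cone 1 b (H w).
  case: wc2; rewrite ltr_norml => w1 /andP[w2 w3].
  by split; [lra|rewrite ltr_norml; lra].
have [_] := Fb _ _ Hc zc; rewrite FH -/w subrr add0r normc_opp => hh.
apply/eqP; rewrite -subr_eq0 -normc_eq0; apply/eqP.
have := normc_ge0 (H w - z); lra.
Qed.

(** The discs of centre [i Y] and radius [Y] exhaust the upper half-plane, so one
    application of the identity principle around [i Y] reaches any given
    point. *)
Theorem right_inverse_extK z : 0 < Im z -> H (F z) = z.
Proof.
move=> z0; have [Y0 HY] := right_inverse_extK_near_infinity.
pose N := Re z ^+ 2 + Im z ^+ 2.
have N0 : 0 <= N by rewrite addr_ge0 ?sqr_ge0.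
(* [|z - i Y| < Y] holds if and only if [|z|^2 < 2 Y Im z] *)
pose Y := Num.max (Num.max 1 Y0) (N / (2 * Im z) + 1).
have [Y1 [YY0 YN]] : 1 <= Y /\ Y0 <= Y /\ N / (2 * Im z) + 1 <= Y.
  have : Y <= Y by []. 
  by rewrite {1}/Y !ge_max => /andP[/andP[-> ->] ->].
have Yp : 0 < Y by lra.
pose p : C := 0 +i* Y.
have dzp : normc (z - p) < Y.
  rewrite -(@ltr_pXn2r _ 2) ?nnegrE ?normc_ge0// ?ltW// sqr_normcE cReB cImB /=.
  have : N <= (Y - 1) * (2 * Im z).
    by rewrite -ler_pdivrMr ?mulr_gt0//; lra.
  rewrite /N; nra.
pose r := (normc (z - p) + Y) / 2.
have dz : normc (z - p) < r by rewrite /r; lra.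
have n0 := normc_ge0 (z - p).
apply/eqP; rewrite -subr_eq0; apply/eqP.
apply: (@identity_principle _ (fun z => H (F z) - z) p r 1 _ _ _ _ z dz) => //.
- by rewrite /r; lra.
- move=> w [_ wI].
  have w0 : 0 < Im w.
    by move: wI; rewrite cImB /= ler_norml /r => /andP[? ?]; lra.
  apply: taylor2D; last exact: taylor2N (taylor2_id w).
  apply: taylor2_comp; first exact: taylor2_recip_cauchy.
  by apply: taylor2_right_inverse_ext => //; exact: Im_recip_cauchy_gt0.
- by move=> w wp; rewrite (HY Y)// subrr.
Qed.

End Subordination.

(** * Boundary regularity of the reciprocal Cauchy transform *)
Section Boundary.
Variables (R : realType) (mu : probR R) (eta a : R) (nu : measR R).
Hypothesis a0 : 0 <= a.
Hypothesis nu_levy : (\int[nu]_t (Num.min 1 (t ^+ 2))%:E < +oo)%E.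
Hypothesis triplet : forall z, right_inverse_dom mu z^-1 ->
  free_cumulant mu z = levy_khintchine eta a nu z.
Local Notation C := R[i].
Implicit Types (z w v h p c : C) (t x B : R).
Local Notation G := (cauchy_transform mu).
Local Notation F := (recip_cauchy mu).
Local Notation H := (right_inverse_ext eta a nu).
Local Notation J := (levy_energy a nu).

Let HFK z (z0 : 0 < Im z) : H (F z) = z := right_inverse_extK a0 nu_levy triplet z0.

Lemma levy_energy_recip_cauchy z : 0 < Im z -> J (F z) < 1.
Proof.
move=> z0; have w0 := Im_recip_cauchy_gt0 mu z0.
rewrite (levy_energy_Im eta a nu_levy w0) HFK// gtrDl oppr_lt0 divr_gt0//.
Qed.

Lemma Im_le_recip_cauchy z : 0 < Im z -> Im z <= Im (F z).
Proof.
move=> z0; have w0 := Im_recip_cauchy_gt0 mu z0.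
rewrite -{1}(HFK z0) (Im_right_inverse_ext eta a nu_levy w0).
by rewrite ler_piMr ?(ltW w0)// lerBlDr lerDl levy_energy_ge0.
Qed.

(** A lower bound, valid for [w] and [w'] of modulus at most [B], for the total
    weight [a / (|w|^2 |w'|^2) + int t^2 / (|w - t|^2 |w' - t|^2) dnu] that
    multiplies [|w - conj w'|^2 / 2] in [Re (1 - E w w')]. *)
Definition coupling_mass (B : R) : R :=
  a / B ^+ 4 + Rintegral nu setT (fun t => t ^+ 2 * (B + `|t|)^-1 ^+ 4).

Lemma rint_coupling_mass B : 0 < B -> rint nu (fun t => t ^+ 2 * (B + `|t|)^-1 ^+ 4).
Proof.
move=> B0; have Bt t : 0 < B + `|t| by rewrite ltr_wpDr.
apply: (rint_le _ (rintZ (B^-1 ^+ 4 + 1) (rint_levy_weight nu_levy))).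
  apply: measurable_funM; first exact: measurable_funX.
  apply: measurable_funX; apply: measurable_funV_ge0; first by move=> t; exact: ltW.
  by apply: measurable_funD => //; exact: measurableT_comp.
move=> t; have p0 : 0 <= t ^+ 2 * (B + `|t|)^-1 ^+ 4.
  by apply: mulr_ge0; rewrite ?sqr_ge0// exprn_ge0// invr_ge0 ltW.
rewrite ger0_norm//.
have BV : 0 <= B^-1 by rewrite invr_ge0 ltW.
have hB : (B + `|t|)^-1 <= B^-1 by rewrite lef_pV2 ?posrE// lerDl.
have hB0 : 0 <= (B + `|t|)^-1 by rewrite invr_ge0 ltW.
rewrite levy_weightE; case: (leP 1 `|t|) => ht.
  rewrite expr1n mulr1 -[t ^+ 2]real_normK ?num_real//.
  have h : `|t| * (B + `|t|)^-1 <= 1 by rewrite ler_pdivrMr// mul1r lerDr ltW.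
  have h' : (B + `|t|)^-1 <= 1 by rewrite invf_le1//; lra.
  rewrite (_ : _ * _ = (`|t| * (B + `|t|)^-1) ^+ 2 * (B + `|t|)^-1 ^+ 2); last by ring.
  apply: (@le_trans _ _ 1); last by rewrite lerDr exprn_ge0.
  by rewrite mulr_ile1 ?exprn_ge0 ?mulr_ge0 ?exprn_ile1 ?mulr_ge0.
rewrite real_normK ?num_real// mulrC ler_wpM2r ?sqr_ge0//.
apply: (@le_trans _ _ (B^-1 ^+ 4)); last by rewrite lerDl.
by rewrite lerXn2r ?nnegrE.
Qed.

Lemma Re_coupling_ge w w' (B : R) : 0 < Im w -> 0 < Im w' -> 0 < B ->
  normc w <= B -> normc w' <= B ->
  1 - (J w + J w') / 2 + normc (w - w') ^+ 2 / 2 * coupling_mass B <=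
  Re (1 - a%:C / (w * w') - levy_coupling nu w w').
Proof.
move=> w0 w0' B0 wB w'B; set D := normc (w - w') ^+ 2 / 2.
have D0 : 0 <= D by rewrite divr_ge0 ?sqr_ge0.
have h1 : Re (a%:C / (w * w')) <= a * ((normc w ^+ 2)^-1 + (normc w' ^+ 2)^-1) / 2
    - D * (a / B ^+ 4).
  have := Re_resolventM_le 0 w0 w0' B0 wB w'B.
  rewrite /resolvent !subr0 normr0 addr0 !normcV !exprVn -/D => h.
  rewrite cReM /= mul0r subr0 invfM.
  by have := ler_wpM2l a0 h; lra.
have h2 : Re (levy_coupling nu w w') <=
    (Rintegral nu setT (fun t => normc (t%:C * resolvent w t) ^+ 2) +
     Rintegral nu setT (fun t => normc (t%:C * resolvent w' t) ^+ 2)) / 2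
    - D * Rintegral nu setT (fun t => t ^+ 2 * (B + `|t|)^-1 ^+ 4).
  have i1 := rint_levy_energy nu_levy w0; have i2 := rint_levy_energy nu_levy w0'.
  have i3 := rint_coupling_mass B0.
  have [i4 _] := cint_levy_coupling nu_levy w0 w0'.
  rewrite -RintegralD// -RintegralZl// -RintegralZr//; last exact: rintD.
  rewrite -RintegralB//; [|by under eq_fun do rewrite mulrC; apply: rintZ; exact: rintD|exact: rintZ].
  apply: le_Rintegral => //.
    apply: rintB; last exact: rintZ.
    by under eq_fun do rewrite mulrC; apply: rintZ; exact: rintD.
  move=> t _; rewrite mulrACA -rmorphM/= cReM /= mul0r subr0 !normcM !exprMn.
  rewrite !normc_real !real_normK ?num_real//.
  have := ler_wpM2l (sqr_ge0 t) (Re_resolventM_le t w0 w0' B0 wB w'B).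
  by rewrite -/D expr2; lra.
rewrite 2!cReB (_ : Re (1 : C) = 1)// /levy_energy /coupling_mass; lra.
Qed.

Lemma recip_cauchy_expand z z' (B : R) : 0 < Im z -> 0 < Im z' -> 0 < B ->
  normc (F z) <= B -> normc (F z') <= B ->
  normc (F z - F z') * (1 - (J (F z) + J (F z')) / 2
    + normc (F z - F z') ^+ 2 / 2 * coupling_mass B) <= normc (z - z').
Proof.
move=> z0 z0' B0 zB zB'.
have w0 := Im_recip_cauchy_gt0 mu z0; have w0' := Im_recip_cauchy_gt0 mu z0'.
have -> : z - z' = H (F z) - H (F z') by rewrite !HFK.
rewrite right_inverse_ext_increment// normcM.
rewrite ler_wpM2l ?normc_ge0//; apply: le_trans (Re_coupling_ge w0 w0' B0 zB zB') _.
by apply: le_trans (ler_norm _) _; exact: Re_le_normc.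
Qed.

Lemma coupling_mass_ge0 B : 0 < B -> 0 <= coupling_mass B.
Proof.
move=> B0; rewrite addr_ge0 ?divr_ge0 ?exprn_ge0 ?(ltW B0)//.
apply: Rintegral_ge0 => t _; apply: mulr_ge0; rewrite ?sqr_ge0//.
by rewrite exprn_ge0// invr_ge0 addr_ge0// ltW.
Qed.

(** Comparison with the fixed point [i]: the energy of [F i] is smaller than one
    by a definite amount, so [|F z - F i|] is at most a multiple of
    [|z - i|]. *)
Lemma recip_cauchy_bounded (B : R) : exists2 B' : R, 0 < B' &
  forall z, 0 < Im z -> normc z <= B -> normc (F z) <= B'.
Proof.
have i0 : 0 < Im ('i%C : C) by [].
have J1 := levy_energy_recip_cauchy i0.
have [w0 w0E] : exists w0, F 'i%C = w0 by exists (F 'i%C).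
rewrite w0E in J1.
have Jp : 0 < 1 - J w0 by rewrite subr_gt0.
exists (normc w0 + 2 * (`|B| + 1) / (1 - J w0) + 1).
  rewrite ltr_wpDl// addr_ge0 ?normc_ge0// divr_ge0 ?(ltW Jp)//.
move=> z z0 zB.
pose B1 := normc (F z) + normc w0 + 1.
have B10 : 0 < B1 by rewrite ltr_wpDl// addr_ge0 ?normc_ge0.
have n1 := normc_ge0 (F z); have n2 := normc_ge0 w0.
have := recip_cauchy_expand z0 i0 B10; rewrite w0E => /(_ _ _)/wrap[];
  [by rewrite /B1; lra|by rewrite /B1; lra|move=> h4].
have h1 : 0 <= normc (F z - w0) ^+ 2 / 2 * coupling_mass B1.
  by apply: mulr_ge0; rewrite ?divr_ge0 ?sqr_ge0 ?coupling_mass_ge0.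
have h2 := levy_energy_recip_cauchy z0.
have h3 : normc (z - 'i%C) <= `|B| + 1.
  apply: le_trans (normcB _ _) _; rewrite lerD ?(le_trans zB) ?ler_norm//.
  by rewrite /= expr0n/= add0r expr1n sqrtr1.
have h5 : normc (F z - w0) * ((1 - J w0) / 2) <= `|B| + 1.
  apply: le_trans h3; apply: le_trans h4; rewrite ler_wpM2l ?normc_ge0//.
  move: h1 h2; move: (J (F z)) (J w0) (_ * coupling_mass B1) => j j' q; lra.
have h6 : normc (F z - w0) <= 2 * (`|B| + 1) / (1 - J w0).
  rewrite ler_pdivlMr//.
  move: h5; move: (J w0) (normc (F z - w0)) => j d; lra.
have := normcD (F z - w0) w0; rewrite subrK; move: h6.
move: (_ / _) (normc (F z)) (normc w0) (normc (F z - w0)) => q x y d; lra.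
Qed.

Lemma coupling_mass_gt0 B : nu [set 0] = 0%E -> 0 < a \/ nu setT != 0%E ->
  0 < B -> 0 < coupling_mass B.
Proof.
move=> nu0 nondeg B0.
have I0 : 0 <= Rintegral nu setT (fun t => t ^+ 2 * (B + `|t|)^-1 ^+ 4).
  apply: Rintegral_ge0 => t _; apply: mulr_ge0; rewrite ?sqr_ge0//.
  by rewrite exprn_ge0// invr_ge0 addr_ge0// ltW.
case: nondeg => [ap|nuT].
  by rewrite ltr_pwDl// divr_gt0// exprn_gt0.
rewrite ltr_wpDl ?divr_ge0 ?exprn_ge0 ?(ltW B0)//.
apply: (@Rintegral_gt0 _ _ _ (~` [set 0])).
- by apply: measurableC; exact: measurable_set1.
- apply: contra_neq nuT => nuC; apply/eqP; rewrite eq_le measure_ge0 andbT.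
  rewrite -(setUv [set (0 : R)]); apply: le_trans (measureU2 _ _ _) _.
  + exact: measurable_set1.
  + by apply: measurableC; exact: measurable_set1.
  + rewrite -[X in (_ <= X)%E]adde0; apply: leeD.
      by rewrite le_eqVlt; apply/orP; left; apply/eqP; exact: nu0.
    by rewrite le_eqVlt; apply/orP; left; apply/eqP; exact: nuC.
- exact: rint_coupling_mass.
- move=> t; apply: mulr_ge0; rewrite ?sqr_ge0//.
  by rewrite exprn_ge0// invr_ge0 addr_ge0// ltW.
- move=> t /eqP t0; rewrite mulr_gt0//; first by rewrite lt_def sqr_ge0 andbT sqrf_eq0.
  by rewrite exprn_gt0// invr_gt0 ltr_wpDr.
Qed.

(** Energies are smaller than one on the range of [F], so the increment formula
    leaves [|w - w'| * c |w - w'|^2 / 2 <= |z - z'|].  The estimate does not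
    degenerate at the real line. *)
Theorem recip_cauchy_holder (B : R) : nu [set 0] = 0%E -> 0 < a \/ nu setT != 0%E ->
  exists2 K : R, 0 < K & forall z z', 0 < Im z -> 0 < Im z' ->
    normc z <= B -> normc z' <= B -> normc (F z - F z') ^+ 3 <= K * normc (z - z').
Proof.
move=> nu0 nondeg; have [B' B'0 FB] := recip_cauchy_bounded B.
have m0 := coupling_mass_gt0 nu0 nondeg B'0.
exists (2 / coupling_mass B'); first by rewrite divr_gt0.
move=> z z' z0 z0' zB zB'.
have := recip_cauchy_expand z0 z0' B'0 (FB _ z0 zB) (FB _ z0' zB').
have h1 := levy_energy_recip_cauchy z0; have h2 := levy_energy_recip_cauchy z0'.
move: h1 h2 m0; have := normc_ge0 (F z - F z').
move: (normc (F z - F z')) (J (F z)) (J (F z')) (coupling_mass B') (normc (z - z')).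
clear => d j j' m e d0 h1 h2 m0 h3.
have h4 : d * (d ^+ 2 / 2 * m) <= e.
  by apply: le_trans h3; rewrite ler_wpM2l//; lra.
rewrite mulrAC ler_pdivlMr//; rewrite (_ : d ^+ 3 = d * d ^+ 2)//; lra.
Qed.

End Boundary.

(** * Stieltjes inversion *)
Section DensityMeasure.
Variable R : realType.
Local Notation mR := (measurableTypeR R).
Local Notation leb := (@lebesgue_measure R).
Local Open Scope ereal_scope.
Variable f : mR -> \bar R.
Hypothesis mf : measurable_fun setT f.
Hypothesis f0 : forall x, 0 <= f x.

(** The two hypotheses are arguments so that the measure structure can be
    attached to the definition. *)
Definition density_measure of measurable_fun setT f & (forall x, 0 <= f x) :=
  fun A : set mR => \int[leb]_(x in A) f x.
Local Notation dm := (density_measure mf f0).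

Let dm0 : dm set0 = 0. Proof. by rewrite /density_measure integral_set0. Qed.
Let dm_ge0 A : 0 <= dm A. Proof. by apply: integral_ge0 => x _; exact: f0. Qed.
Let dm_sigma : semi_sigma_additive dm.
Proof. exact: semi_sigma_additive_nng_induced. Qed.

HB.instance Definition _ := isMeasure.Build _ _ _ dm dm0 dm_ge0 dm_sigma.

End DensityMeasure.

Section Uniqueness.
Variable R : realType.
Local Notation mR := (measurableTypeR R).
Local Notation leb := (@lebesgue_measure R).

Lemma measure_eq_ocitv (m1 m2 : measR R) :
  (forall c d : R, c < d -> m1 `]c, d]%classic = m2 `]c, d]%classic) ->
  (forall c d : R, c < d -> (m1 `]c, d]%classic < +oo)%E) ->
  forall A : set mR, measurable A -> m1 A = m2 A.
Proof.
move=> m12 m1fin A mA.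
apply: (@measure_unique _ R mR (@ocitv R) (fun k : nat => `](- k%:R)%R, k%:R]%classic)
  erefl _ _ _ m1 m2 _ _ A mA).
- exact: ocitvI.
- by move=> k; exists (- k%:R, k%:R).
- apply/seteqP; split => // x _; have := real_truncnS_gt (num_real `|x|).
  set n := (Num.truncn `|x|).+1 => xn; exists n => //=.
  by rewrite in_itv/=; move: xn; rewrite ltr_norml => /andP[-> /ltW].
- by move=> B /ocitvP[->|[[c d]/= cd ->]]; [rewrite !measure0|exact: m12].
- move=> [|k]; first by rewrite oppr0 set_itv_ge ?measure0 ?ltry//= bnd_simp ltxx.
  by apply: m1fin; rewrite gtrN.
Qed.

(** The restriction to [D] makes the lemma applicable to a density that is known
    on an interval only. *)
Lemma density_of_intervals (m : {finite_measure set mR -> \bar R}) (f : R -> R) (D : set R) :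
  measurable (D : set mR) -> measurable_fun (D : set mR) f ->
  (forall x, D x -> 0 <= f x) ->
  (forall c d : R, c < d ->
    m (`]c, d]%classic `&` D) = (\int[leb]_(x in `]c, d]%classic `&` D) (f x)%:E)%E) ->
  forall A : set mR, measurable A -> m (A `&` D) = (\int[leb]_(x in A `&` D) (f x)%:E)%E.
Proof.
move=> mD mf f0 fI A mA.
pose g : mR -> \bar R := (EFin \o f) \_ D.
have mg : measurable_fun setT g.
  by apply/(measurable_restrictT _ mD); exact/measurable_EFinP.
have g0 x : (0 <= g x)%E.
  by rewrite /g patchE; case: ifPn => // /set_mem/f0; rewrite lee_fin.
have := @measure_eq_ocitv (mrestr m mD) (density_measure mg g0) _ _ A mA.
rewrite /= /mrestr /density_measure /g -integral_mkcondr; apply.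
  by move=> c d cd; rewrite /= /mrestr /density_measure /g -integral_mkcondr; exact: fI.
move=> c d _; rewrite /= /mrestr; apply: (@le_lt_trans _ _ (m setT)).
  by apply: le_measure; rewrite ?inE//; exact: measurableI.
by rewrite -ge0_fin_numE//; exact: fin_num_measure.
Qed.

End Uniqueness.

Section Stieltjes.
Variables (R : realType) (mu : probR R).
Local Notation C := R[i].
Local Notation mR := (measurableTypeR R).
Local Notation leb := (@lebesgue_measure R).
Implicit Types (z w : C) (t x y c d M : R).
Local Notation G := (cauchy_transform mu).

Definition poisson y x t : R := y / ((x - t) ^+ 2 + y ^+ 2).

Lemma poisson_den_gt0 y x t : 0 < y -> 0 < (x - t) ^+ 2 + y ^+ 2.
Proof. by move=> y0; rewrite ltr_wpDl ?sqr_ge0 ?exprn_gt0. Qed.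

Lemma poisson_ge0 y x t : 0 < y -> 0 <= poisson y x t.
Proof. by move=> y0; rewrite divr_ge0 ?(ltW y0)// ltW// poisson_den_gt0. Qed.

Lemma poisson_peak y x : 0 < y -> y * poisson y x x = 1.
Proof.
by move=> y0; rewrite /poisson subrr expr0n/= add0r; field; rewrite gt_eqF.
Qed.

Lemma poissonE y x t : 0 < y -> poisson y x t = y * normc (resolvent (x +i* y) t) ^+ 2.
Proof. by move=> y0; rewrite normcV exprVn sqr_normcE cReB cImB /= subr0. Qed.

Lemma rint_poisson y x : 0 < y -> rint mu (poisson y x).
Proof.
move=> y0; have := rintZ y (@rint_sqr_resolvent _ mu (x +i* y) y0).
by congr (rint _); apply/funext => t; rewrite poissonE.
Qed.

Lemma Im_cauchy_transform_poisson y x : 0 < y ->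
  - Im (G (x +i* y)) = Rintegral mu setT (poisson y x).
Proof.
move=> y0; rewrite Im_cauchy_transform// mulNr opprK -RintegralZl//.
  by apply: eq_Rintegral => t _; exact/esym/(poissonE x t y0).
exact: rint_sqr_resolvent.
Qed.

Lemma harmonic_gt0 n : 0 < n.+1%:R^-1 :> R. Proof. by rewrite invr_gt0. Qed.

(** [y * poisson y x] is bounded by one and tends to the indicator of [x]. *)
Lemma cvg_atom x :
  n.+1%:R^-1 * - Im (G (x +i* n.+1%:R^-1)) @[n --> \oo] --> fine (mu [set x]).
Proof.
have -> : fine (mu [set x]) = Rintegral mu setT (\1_[set x]).
  rewrite /Rintegral; congr fine.
  by rewrite integral_indic ?setIT//; exact: measurable_set1.
under eq_cvg => n do rewrite Im_cauchy_transform_poisson ?harmonic_gt0//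
  -(RintegralZl _ _ (rint_poisson x (harmonic_gt0 n)))//.
apply: (@Rintegral_dominated_cvg _ _ _ _ (fun=> 1)).
- by move=> n; exact: (rint_meas (rintZ _ (rint_poisson x (harmonic_gt0 n)))).
- exact: rint_prob_cst.
- move=> n t; have p0 := harmonic_gt0 n; set y := n.+1%:R^-1 in p0 *.
  rewrite ger0_norm; last exact: mulr_ge0 (ltW p0) (poisson_ge0 x t p0).
  rewrite /poisson mulrA ler_pdivrMr ?poisson_den_gt0// mul1r -expr2.
  by rewrite lerDr sqr_ge0.
- move=> t; rewrite indicE; have [->|tx] := eqVneq t x.
    rewrite mem_set//; apply: cvg_near_cst; apply: nearW => n.
    exact: poisson_peak (harmonic_gt0 n).
  rewrite memNset; last by move=> /= /eqP; rewrite (negbTE tx).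
  have c0 : 0 < (x - t) ^+ 2 by rewrite lt_def sqr_ge0 sqrf_eq0 subr_eq0 eq_sym tx.
  apply: (@squeeze_cvgr _ _ _ _ (fun=> 0) (fun n => ((x - t) ^+ 2)^-1 * harmonic n)).
  + apply: nearW => n; have p0 := harmonic_gt0 n; rewrite /harmonic/=.
    have p1 : n.+1%:R^-1 <= 1 :> R by rewrite invf_le1// ler1n.
    set y := n.+1%:R^-1 in p0 p1 *.
    rewrite (mulr_ge0 (ltW p0) (poisson_ge0 x t p0))/=.
    rewrite mulrC ler_wpM2r ?(ltW p0)// /poisson.
    rewrite ler_pdivrMr ?poisson_den_gt0// mulrDr mulVf ?gt_eqF//.
    by rewrite (le_trans p1)// lerDl mulr_ge0 ?sqr_ge0 ?invr_ge0 ?sqr_ge0.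
  + exact: cvg_cst.
  + rewrite -[X in _ --> X](mulr0 ((x - t) ^+ 2)^-1).
    by apply: cvgMl_tmp; exact: cvg_harmonic.
Qed.

Definition arctan_gap y c d t : R := atan ((d - t) / y) - atan ((c - t) / y).

Lemma integral_poisson y c d t : 0 < y -> c < d ->
  (\int[leb]_(x in `[c, d]) (poisson y x t)%:E)%E = (arctan_gap y c d t)%:E.
Proof.
move=> y0 cd.
have cF x : {for x, continuous (fun x => atan ((x - t) / y))}.
  apply: continuous_comp; last exact: continuous_atan.
  apply: cvgM; last exact: cvg_cst.
  by apply: cvgB; [exact: cvg_id|exact: cvg_cst].
rewrite (@continuous_FTC2 _ (fun x => poisson y x t) (fun x => atan ((x - t) / y)))//.
- apply: continuous_in_subspaceT => x _; apply: cvgM; first exact: cvg_cst.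
  apply: cvgV; first by rewrite gt_eqF ?poisson_den_gt0.
  apply: cvgD; last exact: cvg_cst.
  have xt : (u - t) @[u --> x] --> x - t by apply: cvgB; [exact: cvg_id|exact: cvg_cst].
  exact: (cvgM xt xt).
- split.
  + move=> x _; exact: ex_derive.
  + by apply: cvg_at_right_filter; exact: cF.
  + by apply: cvg_at_left_filter; exact: cF.
- move=> x _; rewrite derive1E derive_val /poisson.
  have p0 := poisson_den_gt0 x t y0.
  rewrite scaler0 add0r subr0 /GRing.scale/= mulr1; field.
  by rewrite !gt_eqF// addrC.
Qed.

Lemma measurable_Im_cauchy_transform y : 0 < y ->
  measurable_fun (setT : set mR) (fun x => - Im (G (x +i* y))).
Proof.
move=> y0; apply: continuous_measurable_fun => x; apply: cvgN.
apply/cvgrPdist_lt => e e0.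
have [b b0 H] := bigO1_small (taylor2_bigO1 (@taylor2_cauchy_transform R mu (x +i* y) y0)) e0.
exists b => // x' xx'; rewrite /= in xx'.
rewrite distrC -cImB; apply: le_lt_trans (Im_le_normc _) _.
have -> : x' +i* y = (x +i* y) + (x' - x)%:C.
  by apply: complexP => /=; [rewrite addrC subrK|rewrite addr0].
by apply: H; rewrite normc_real distrC.
Qed.

(** Fubini, and the primitive of the Poisson kernel. *)
Lemma integral_Im_cauchy_transform y c d : 0 < y -> c < d ->
  (\int[leb]_(x in `[c, d]) (- Im (G (x +i* y)))%:E =
   \int[mu]_t (arctan_gap y c d t)%:E)%E.
Proof.
move=> y0 cd; pose D : set mR := `[c, d]%classic.
pose f (xt : mR * mR) := (poisson y xt.1 xt.2 * \1_D xt.1)%:E.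
have mD : measurable D by exact: measurable_itv.
have mf : measurable_fun setT f.
  apply/measurable_EFinP; apply: measurable_funM; last first.
    by apply: measurableT_comp => //; exact: measurable_indic.
  apply: measurable_funM => //; apply: measurable_funV_ge0.
    by move=> xt; apply/ltW/poisson_den_gt0.
  apply: measurable_funD => //; apply: measurable_funX.
  by apply: measurable_funB.
have f0 xt : (0 <= f xt)%E.
  by rewrite lee_fin; apply: mulr_ge0; [exact: poisson_ge0|].
have h1 x : (\int[mu]_t f (x, t) = (((fun x => (- Im (G (x +i* y)))%:E) \_ D) x))%E.
  rewrite patchE /f /=; case: ifPn => xD.
    rewrite indicE xD; under eq_integral do rewrite mulr1.
    rewrite Im_cauchy_transform_poisson// /Rintegral fineK//.
    exact: integrable_fin_num (rint_poisson x y0).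
  rewrite indicE (negbTE xD); under eq_integral do rewrite mulr0.
  by rewrite integral0.
have h2 t : (\int[leb]_x f (x, t) = (arctan_gap y c d t)%:E)%E.
  rewrite -integral_poisson// [RHS]integral_mkcond; apply: eq_integral => x _.
  by rewrite patchE /f /= indicE; case: ifPn => _; rewrite ?mulr1 ?mulr0.
rewrite [LHS]integral_mkcond; under eq_integral do rewrite -h1.
rewrite fubini_tonelli//; apply: eq_integral => t _; exact: h2.
Qed.

Lemma cvg_atan_ratio (s : R) :
  atan (s / n.+1%:R^-1) @[n --> \oo] --> pi / 2 * Num.sg s.
Proof.
have pos (r : R) : 0 < r -> atan (r / n.+1%:R^-1) @[n --> \oo] --> pi / 2.
  move=> r0; apply: (@cvg_comp _ _ _ (fun n => r / n.+1%:R^-1) (@atan R) _ +oo) => //.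
    apply/cvgryPge => A; near=> n; rewrite invrK -ler_pdivrMl//.
    apply: (@le_trans _ _ n%:R); last by rewrite ler_nat.
    by near: n; exact: nbhs_infty_ger.
  exact: cvgy_atan.
have [s0|s0|->] := ltgtP s 0.
- rewrite ltr0_sg// mulrN1.
  have -> : (fun n : nat => atan (s / n.+1%:R^-1)) =
      (fun n : nat => - atan (- s / n.+1%:R^-1)).
    by apply/funext => n; rewrite mulNr atanN opprK.
  by apply: cvgN; apply: pos; rewrite oppr_gt0.
- by rewrite gtr0_sg// mulr1; exact: pos.
- rewrite sgr0 mulr0.
  have -> : (fun n : nat => atan (0 / n.+1%:R^-1)) = (fun=> 0 : R).
    by apply/funext => n; rewrite mul0r atan0.
  exact: cvg_cst.
Unshelve. all: by end_near. Qed.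

(** The endpoints get half weight in the limit; this is harmless once they are
    known not to be atoms. *)
Lemma sg_gap c d t : c < d ->
  pi / 2 * Num.sg (d - t) - pi / 2 * Num.sg (c - t) =
  pi * \1_`]c, d] t + pi / 2 * \1_[set c] t - pi / 2 * \1_[set d] t :> R.
Proof.
move=> cd.
have i1 x : \1_[set x] t = (t == x)%:R :> R.
  rewrite indicE; congr ((nat_of_bool _)%:R).
  by apply/idP/eqP => [/set_mem|->]; [|exact: mem_set].
have sg_pos (x : R) : t < x -> Num.sg (x - t) = 1.
  by move=> tx; rewrite gtr0_sg// subr_gt0.
have sg_neg (x : R) : x < t -> Num.sg (x - t) = -1.
  by move=> tx; rewrite ltr0_sg// subr_lt0.
rewrite !i1 indicE mem_setE /= in_itv/=.
case: (ltgtP t c) => [tc|ct|->].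
- have td := lt_trans tc cd.
  by rewrite (ltW td) (lt_eqF td)/= !sg_pos//; lra.
- rewrite (sg_neg c)//; case: (ltgtP t d) => [td|dt|->].
  + by rewrite /= sg_pos//; lra.
  + by rewrite /= sg_neg//; lra.
  + by rewrite /= subrr sgr0; lra.
- by rewrite (lt_eqF cd) /= subrr sgr0 gtr0_sg ?subr_gt0//; lra.
Qed.

Lemma normr_arctan_gap_le y c d t : `|arctan_gap y c d t| <= pi.
Proof.
rewrite /arctan_gap ler_norml.
have := atan_gtNpi2 ((d - t) / y); have := atan_ltpi2 ((d - t) / y).
have := atan_gtNpi2 ((c - t) / y); have := atan_ltpi2 ((c - t) / y).
lra.
Qed.

Lemma measurable_arctan_gap y c d :
  measurable_fun (setT : set mR) (arctan_gap y c d).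
Proof.
apply: measurable_funB; apply: continuous_measurable_fun => t;
  (apply: continuous_comp; last exact: continuous_atan);
  apply: cvgM; [|exact: cvg_cst| |exact: cvg_cst];
  by apply: cvgB; [exact: cvg_cst|exact: cvg_id].
Qed.

Lemma rint_arctan_gap y c d : rint mu (arctan_gap y c d).
Proof.
apply: (rint_le (measurable_arctan_gap y c d) (rint_prob_cst mu pi)) => t.
exact: normr_arctan_gap_le.
Qed.

Lemma cvg_integral_arctan_gap c d : c < d ->
  Rintegral mu setT (arctan_gap n.+1%:R^-1 c d) @[n --> \oo] -->
  pi * fine (mu `]c, d]%classic) + pi / 2 * fine (mu [set c]) - pi / 2 * fine (mu [set d]).
Proof.
move=> cd.
have iI (A : set mR) : measurable A -> rint mu (\1_A).
  by move=> mA; exact: integrable_indic.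
have II (A : set mR) : measurable A -> Rintegral mu setT (\1_A) = fine (mu A).
  by move=> mA; rewrite /Rintegral integral_indic ?setIT.
have mcd : measurable (`]c, d]%classic : set mR) by exact: measurable_itv.
have m1 (x : R) : measurable ([set x] : set mR) by exact: measurable_set1.
rewrite -!II// -!RintegralZl//; try exact: iI.
rewrite -RintegralD//; [|exact/rintZ/iI..].
rewrite -RintegralB//; [|by apply: rintD; exact/rintZ/iI|exact/rintZ/iI].
apply: (@Rintegral_dominated_cvg _ _ _ _ (fun=> pi)).
- by move=> n; exact: measurable_arctan_gap.
- exact: rint_prob_cst.
- by move=> n t; exact: normr_arctan_gap_le.
- move=> t /=; rewrite -sg_gap//; apply: cvgB; exact: cvg_atan_ratio.
Qed.

Lemma no_atom x M : (forall n, `|Im (G (x +i* n.+1%:R^-1))| <= M) ->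
  fine (mu [set x]) = 0.
Proof.
move=> GM; have h := @cvg_atom x.
suff : n.+1%:R^-1 * - Im (G (x +i* n.+1%:R^-1)) @[n --> \oo] --> (0 : R).
  by move=> h0; exact: (cvg_unique _ h h0).
apply/norm_cvg0P.
apply: (@squeeze_cvgr _ _ _ _ (fun=> 0) (fun n => M * harmonic n)).
- apply: nearW => n; apply/andP; split; first exact: normr_ge0.
  rewrite normrM normrN mulrC (ger0_norm (ltW (harmonic_gt0 n))).
  by rewrite /harmonic ler_wpM2r ?GM// ltW ?harmonic_gt0.
- exact: cvg_cst.
- by rewrite -[X in _ --> X](mulr0 M); apply: cvgMl_tmp; exact: cvg_harmonic.
Qed.

(** Boundedness of the Cauchy transform near the axis excludes atoms and gives
    dominated convergence over the interval. *)
Lemma interval_mass c d M (g : R -> R) : c < d ->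
  (forall x n, c <= x <= d -> `|Im (G (x +i* n.+1%:R^-1))| <= M) ->
  (forall x, c <= x <= d -> - Im (G (x +i* n.+1%:R^-1)) @[n --> \oo] --> g x) ->
  measurable_fun (`[c, d]%classic : set mR) g /\
  (mu `]c, d]%classic = \int[leb]_(x in `]c, d]%classic) (g x / pi)%:E)%E.
Proof.
move=> cd GM Gg.
have mg : measurable_fun (`[c, d]%classic : set mR) g.
  apply: (@measurable_fun_cvg _ _ R _ (fun n x => - Im (G (x +i* n.+1%:R^-1)))).
    by move=> n; apply: measurable_funTS; exact: measurable_Im_cauchy_transform (harmonic_gt0 n).
  by move=> x; rewrite /= in_itv/= => /Gg.
split => //.
have GM' x n : c <= x <= d -> `|- Im (G (x +i* n.+1%:R^-1))| <= M.
  by move=> xcd; rewrite normrN GM.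
pose Gn (n : nat) (x : mR) := (- Im (G (x +i* n.+1%:R^-1)))%:E.
have mGn n : measurable_fun (`[c, d]%classic : set mR) (Gn n).
  apply/measurable_EFinP; apply: measurable_funTS.
  exact: measurable_Im_cauchy_transform (harmonic_gt0 n).
have atoms x : c <= x <= d -> fine (mu [set x]) = 0.
  by move=> xcd; apply: (@no_atom x M) => n; exact: GM.
have L := cvg_integral_arctan_gap cd.
rewrite !atoms ?lexx ?(ltW cd)// !mulr0 addr0 subr0 in L.
have mcd : measurable (`[c, d]%classic : set mR) by exact: measurable_itv.
have lf : (leb `[c, d]%classic < +oo)%E.
  by rewrite lebesgue_measure_itv/= lte_fin cd ltry.
have iM : leb.-integrable `[c, d] (fun=> M%:E).
  apply/integrableP; split; first exact: measurable_cst.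
  by rewrite integral_cst//= lte_mul_pinfty.
have aeG : {ae leb, forall x, `[c, d]%classic x -> Gn ^~ x @ \oo --> (EFin \o g) x}.
  apply: aeW => x; rewrite /= in_itv/= => xcd.
  by apply: cvg_EFin; [exact: nearW|exact: Gg].
have aeM : {ae leb, forall x n, `[c, d]%classic x -> (`|Gn n x| <= M%:E)%E}.
  by apply: aeW => x n; rewrite /= in_itv/= => xcd; rewrite lee_fin GM' //.
have [ig _ cg] := @dominated_convergence _ _ _ leb _ mcd Gn (EFin \o g) (fun=> M%:E)
  mGn ((measurable_EFinP _ _).2 mg) aeG iM aeM.
have GnE n : (\int[leb]_(x in `[c, d]) Gn n x)%E =
    (Rintegral mu setT (arctan_gap n.+1%:R^-1 c d))%:E.
  rewrite integral_Im_cauchy_transform ?harmonic_gt0// /Rintegral fineK//.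
  exact: (integrable_fin_num measurableT (rint_arctan_gap _ _ _)).
have key : (\int[leb]_(x in `[c, d]) (g x)%:E)%E = (pi * fine (mu `]c, d]%classic))%:E.
  apply: (cvg_unique _ cg); first exact: ereal_hausdorff.
  rewrite /= (_ : (fun n => _) = (fun n : nat =>
    (Rintegral mu setT (arctan_gap n.+1%:R^-1 c d))%:E)); last exact/funext/GnE.
  by apply: cvg_EFin; [exact: nearW|exact: L].
have mg' : measurable_fun (`]c, d]%classic : set mR) g.
  apply: measurable_funS mg => //; exact: subset_itv_oc_cc.
have ig' : leb.-integrable `]c, d] (EFin \o g).
  apply: integrableS ig => //; exact: subset_itv_oc_cc.
under eq_integral do rewrite mulrC EFinM.
rewrite integralZl//= integral_itv_obnd_cbnd; last exact/measurable_EFinP.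
rewrite key -EFinM mulKf ?gt_eqF ?pi_gt0// fineK// fin_num_measure//.
Qed.

End Stieltjes.

(** * Densities and atoms *)
Section Density.
Variables (R : realType) (mu : probR R) (eta a : R) (nu : measR R).
Hypothesis a0 : 0 <= a.
Hypothesis nu0 : nu [set 0] = 0%E.
Hypothesis nu_levy : (\int[nu]_t (Num.min 1 (t ^+ 2))%:E < +oo)%E.
Hypothesis triplet : forall z, right_inverse_dom mu z^-1 ->
  free_cumulant mu z = levy_khintchine eta a nu z.
Local Notation C := R[i].
Local Notation mR := (measurableTypeR R).
Local Notation leb := (@lebesgue_measure R).
Implicit Types (z w v h p : C) (t x c d k e : R).
Local Notation G := (cauchy_transform mu).
Local Notation F := (recip_cauchy mu).
Local Notation H := (right_inverse_ext eta a nu).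
Local Notation J := (levy_energy a nu).

Definition away_from_zero c d k := 0 < k /\
  forall z, c <= Re z <= d -> 0 < Im z <= 1 -> k <= normc (F z).

(** [pi] times the density that Stieltjes inversion assigns to [mu]. *)
Definition boundary_density x : R :=
  limn (fun n => - Im (G (x +i* n.+1%:R^-1))).

Lemma harmonic_le1 n : n.+1%:R^-1 <= 1 :> R.
Proof. by rewrite invf_le1// ler1n. Qed.

Lemma harmonic_in01 n : 0 < (n.+1%:R^-1 : R) <= 1.
Proof. by rewrite harmonic_gt0 harmonic_le1. Qed.

Lemma cauchy_transformV z : G z = (F z)^-1.
Proof. by rewrite /recip_cauchy invrK. Qed.

Lemma Im_cauchy_transform_bounded c d k z : away_from_zero c d k ->
  c <= Re z <= d -> 0 < Im z <= 1 -> `|Im (G z)| <= k^-1.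
Proof.
move=> [k0 Fk] zcd z1; apply: le_trans (Im_le_normc _) _.
have h := Fk _ zcd z1; rewrite cauchy_transformV normcV lef_pV2 ?posrE//.
exact: lt_le_trans h.
Qed.

(** [G = 1 / F] inherits the uniform continuity of [F] where [F] is bounded
    below. *)
Lemma cauchy_transform_unif_continuous c d k e : 0 < a \/ nu setT != 0%E ->
  away_from_zero c d k -> 0 < e ->
  exists2 b : R, 0 < b & forall z z',
    c <= Re z <= d -> c <= Re z' <= d -> 0 < Im z <= 1 -> 0 < Im z' <= 1 ->
    normc (z - z') < b -> `|Im (G z) - Im (G z')| < e.
Proof.
move=> nondeg [k0 Fk] e0.
have [K K0 FK] := recip_cauchy_holder a0 nu_levy triplet (`|c| + `|d| + 1) nu0 nondeg.
have q0 : 0 < e * k ^+ 2 by rewrite mulr_gt0 ?exprn_gt0.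
exists ((e * k ^+ 2) ^+ 3 / K); first by rewrite divr_gt0// exprn_gt0.
move=> z z' zcd z'cd z1 z'1 zz'.
have bd v : c <= Re v <= d -> 0 < Im v <= 1 -> normc v <= `|c| + `|d| + 1.
  move=> /andP[v1 v2] /andP[v3 v4]; apply: le_trans (normc_le _) _.
  rewrite (gtr0_norm v3) lerD// ler_norml; apply/andP; split.
    have := ler_norm (- c); rewrite normrN; have := normr_ge0 d; lra.
  have := ler_norm d; have := normr_ge0 c; lra.
have [/andP[z0 _] /andP[z'0 _]] := (z1, z'1).
have hF := FK _ _ z0 z'0 (bd _ zcd z1) (bd _ z'cd z'1).
have dF : normc (F z - F z') < e * k ^+ 2.
  rewrite -(@ltr_pXn2r _ 3) ?nnegrE ?normc_ge0 ?(ltW q0)//.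
  by apply: le_lt_trans hF _; rewrite mulrC -ltr_pdivlMr.
have h1 := Fk _ zcd z1; have h2 := Fk _ z'cd z'1.
have n1 : 0 < normc (F z) by exact: lt_le_trans h1.
have n2 : 0 < normc (F z') by exact: lt_le_trans h2.
rewrite -cImB; apply: le_lt_trans (Im_le_normc _) _; rewrite !cauchy_transformV.
rewrite (_ : _ - _ = (F z' - F z) / (F z * F z')); last first.
  by field; rewrite -!normc_gt0 n1 n2.
rewrite normcM normcV ltr_pdivrMr ?normc_gt0 ?mulf_neq0 -?normc_gt0//.
rewrite normcBC; apply: lt_le_trans dF _; rewrite ler_pM2l// normcM expr2.
by rewrite ler_pM// ltW.
Qed.

Lemma boundary_density_cvg c d k x : 0 < a \/ nu setT != 0%E ->
  away_from_zero c d k -> c <= x <= d ->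
  - Im (G (x +i* n.+1%:R^-1)) @[n --> \oo] --> boundary_density x.
Proof.
move=> nondeg good xcd; suff : cvgn (fun n => - Im (G (x +i* n.+1%:R^-1))) by [].
apply/cauchy_cvgP/cauchy_exP => e e0.
have [b b0 Gb] := cauchy_transform_unif_continuous nondeg good e0.
have [N _ HN] : \forall n \near \oo, `|0 - harmonic n| < b :> R.
  by apply: cvgr_dist_lt; [exact: cvg_harmonic|].
exists (- Im (G (x +i* N.+1%:R^-1))); exists N => // n /= Nn.
suff h : `|- Im (G (x +i* N.+1%:R^-1)) - - Im (G (x +i* n.+1%:R^-1))| < e by exact: h.
rewrite -opprD normrN; apply: Gb; rewrite ?harmonic_in01//=.
rewrite subrr expr0n/= add0r sqrtr_sqr.
have := HN N (leqnn N); have := HN n Nn; rewrite /harmonic /= !sub0r !normrN.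
rewrite (gtr0_norm (harmonic_gt0 R n)) (gtr0_norm (harmonic_gt0 R N)) => hn hN.
rewrite ltr_norml.
move: hn hN (harmonic_gt0 R n) (harmonic_gt0 R N).
by move: (n.+1%:R^-1) (N.+1%:R^-1) => u v; lra.
Qed.

Lemma boundary_density_ge0 c d k x : 0 < a \/ nu setT != 0%E ->
  away_from_zero c d k -> c <= x <= d -> 0 <= boundary_density x.
Proof.
move=> nondeg good xcd.
apply: (cvgr_to_ge (boundary_density_cvg nondeg good xcd)); apply: nearW => n.
by rewrite oppr_ge0 ltW// Im_cauchy_transform_lt0//= harmonic_gt0.
Qed.

Lemma boundary_density_unif_continuous c d k e : 0 < a \/ nu setT != 0%E ->
  away_from_zero c d k -> 0 < e ->
  exists2 b : R, 0 < b & forall x x', c <= x <= d -> c <= x' <= d ->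
    `|x - x'| < b -> `|boundary_density x - boundary_density x'| <= e.
Proof.
move=> nondeg good e0.
have [b b0 Gb] := cauchy_transform_unif_continuous nondeg good e0.
exists b => // x x' xcd x'cd xx'.
have h := cvgB (boundary_density_cvg nondeg good xcd) (boundary_density_cvg nondeg good x'cd).
apply: (cvgr_to_le (cvg_norm (h _))); apply: nearW => n.
rewrite [X in `|X|](_ : _ = - Im (G (x +i* n.+1%:R^-1)) - - Im (G (x' +i* n.+1%:R^-1)))//.
rewrite -opprD normrN; apply: ltW; apply: Gb; rewrite ?harmonic_in01//=.
by rewrite subrr expr0n/= addr0 sqrtr_sqr.
Qed.

Lemma boundary_density_mass c d k : 0 < a \/ nu setT != 0%E -> c < d ->
  away_from_zero c d k ->
  measurable_fun (`[c, d]%classic : set mR) boundary_density /\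
  (mu `]c, d]%classic = \int[leb]_(x in `]c, d]%classic) (boundary_density x / pi)%:E)%E.
Proof.
move=> nondeg cd good; apply: (@interval_mass _ _ _ _ k^-1) => //.
  by move=> x n xcd; apply: Im_cauchy_transform_bounded good _ _ => //=; rewrite harmonic_in01.
by move=> x xcd; exact: (boundary_density_cvg nondeg good xcd).
Qed.

Lemma away_from_zeroW c d c' d' k : away_from_zero c d k -> c <= c' -> d' <= d ->
  away_from_zero c' d' k.
Proof.
by move=> [k0 Fk] cc' dd'; split=> // z /andP[z1 z2]; apply: Fk; apply/andP; split; lra.
Qed.

Lemma null_where_away_from_zero c d k (A : set mR) : 0 < a \/ nu setT != 0%E -> c < d ->
  away_from_zero c d k -> measurable A -> leb A = 0%E -> mu (A `&` `]c, d]%classic) = 0%E.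
Proof.
move=> nondeg cd good mA A0.
have [mb _] := boundary_density_mass nondeg cd good.
have mD : measurable (`]c, d]%classic : set mR) by exact: measurable_itv.
have mf : measurable_fun (`]c, d]%classic : set mR) (fun x => boundary_density x / pi).
  apply: measurable_funM => //; apply: measurable_funS mb => //.
  exact: subset_itv_oc_cc.
have mAD : measurable (A `&` `]c, d]%classic) by exact: measurableI.
rewrite (@density_of_intervals R mu (fun x => boundary_density x / pi) `]c, d]%classic)//.
- apply: null_set_integral => //.
    by apply/measurable_EFinP; apply: measurable_funS mf => // x [].
  by apply/eqP; rewrite eq_le measure_ge0 andbT -A0 le_measure ?inE//; apply: subIsetl.
- move=> x; rewrite /= in_itv/= => /andP[/ltW cx xd].
  by rewrite divr_ge0 ?pi_ge0// (boundary_density_ge0 nondeg good)// cx.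
- move=> c' d' cd'.
  have -> : `]c', d']%classic `&` `]c, d]%classic =
      `]Num.max c' c, Num.min d' d]%classic :> set mR.
    apply/seteqP; split => x /=; rewrite !in_itv/= gt_max le_min.
      by move=> [/andP[-> ->] /andP[-> ->]].
    by move=> /andP[/andP[-> ->] /andP[-> ->]].
  have [h|h] := ltP (Num.max c' c) (Num.min d' d).
    have h1 : c <= Num.max c' c by rewrite le_max lexx orbT.
    have h2 : Num.min d' d <= d by rewrite ge_min lexx orbT.
    by have [_] := boundary_density_mass nondeg h (away_from_zeroW good h1 h2).
  by rewrite set_itv_ge ?bnd_simp -?leNgt// measure0 integral_set0.
Qed.

Lemma continuous_density k : 0 < a \/ nu setT != 0%E ->
  (forall c d, away_from_zero c d k) ->
  mu `<< leb /\ exists f : R -> R, continuous f /\ is_density mu f.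
Proof.
move=> nondeg good; pose f x := boundary_density x / pi.
have fc : continuous f.
  move=> x; apply: cvgM; last exact: cvg_cst.
  apply/cvgrPdist_le => e e0.
  have [b b0 fb] := boundary_density_unif_continuous nondeg (good (x - 1) (x + 1)) e0.
  exists (Num.min b 1); first by rewrite /= lt_min b0 ltr01.
  move=> x' /=; rewrite lt_min => /andP[xb x1].
  by apply: fb => //; move: x1; rewrite ?ltr_norml; lra.
have f0 x : 0 <= f x.
  by rewrite divr_ge0 ?pi_ge0// (boundary_density_ge0 nondeg (good x x))// lexx.
have mf : measurable_fun (setT : set mR) f by exact: continuous_measurable_fun.
have dens (A : set mR) : measurable A -> mu A = (\int[leb]_(x in A) (f x)%:E)%E.
  move=> mA; rewrite -[A]setIT.
  apply: (@density_of_intervals R mu f setT) => // c d cd.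
  by rewrite setIT; have [_] := boundary_density_mass nondeg cd (good c d).
split; last by exists f; split; [exact: fc|split].
apply/null_content_dominatesP => A mA A0; rewrite dens//.
apply: null_set_integral => //; apply/measurable_EFinP.
exact: measurable_funTS.
Qed.

End Density.

(** * Location of the zeros of the reciprocal Cauchy transform *)
Section Zeros.
Variables (R : realType) (mu : probR R) (eta a : R) (nu : measR R).
Hypothesis a0 : 0 <= a.
Hypothesis nu0 : nu [set 0] = 0%E.
Hypothesis nu_levy : (\int[nu]_t (Num.min 1 (t ^+ 2))%:E < +oo)%E.
Hypothesis triplet : forall z, right_inverse_dom mu z^-1 ->
  free_cumulant mu z = levy_khintchine eta a nu z.
Local Notation C := R[i].
Local Notation mR := (measurableTypeR R).
Local Notation leb := (@lebesgue_measure R).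
Implicit Types (z w v h p : C) (t x c d k e : R).
Local Notation G := (cauchy_transform mu).
Local Notation F := (recip_cauchy mu).
Local Notation H := (right_inverse_ext eta a nu).
Local Notation J := (levy_energy a nu).

Let HFK z (z0 : 0 < Im z) : H (F z) = z := right_inverse_extK a0 nu_levy triplet z0.
Let JF z (z0 : 0 < Im z) : J (F z) < 1 :=
  levy_energy_recip_cauchy a0 nu_levy triplet z0.

Lemma recip_cauchy_ge_gaussian z : 0 < Im z -> Num.sqrt a <= normc (F z).
Proof.
move=> z0; have w0 := Im_recip_cauchy_gt0 mu z0.
have n0 : 0 < normc (F z) by rewrite normc_gt0 Im_gt0_neq0.
rewrite -[normc (F z)]ger0_norm ?normc_ge0// -sqrtr_sqr ler_sqrt ?sqr_ge0//.
have h : a / normc (F z) ^+ 2 <= 1.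
  apply: le_trans (ltW (JF z0)); rewrite /levy_energy lerDl.
  by apply: Rintegral_ge0 => t _; exact: sqr_ge0.
by move: h; rewrite ler_pdivrMr ?exprn_gt0// mul1r.
Qed.

Lemma nu_setC0 : nu (~` [set (0 : R)] : set mR) = nu setT.
Proof.
have m0 : measurable ([set (0 : R)] : set mR) by exact: measurable_set1.
apply/eqP; rewrite eq_le; apply/andP; split.
  by apply: le_measure; rewrite ?inE//; exact: measurableC.
rewrite -{1}(setUv [set (0 : R)]); apply: le_trans (measureU2 _ _ _) _ => //.
  exact: measurableC.
rewrite -[X in (_ <= X)%E]add0e; apply: leeD => //.
by rewrite le_eqVlt; apply/orP; left; apply/eqP; exact: nu0.
Qed.

(** The integrals of [t^2 / (|t| + 1 / (n + 1))^2] increase to the mass of [nu],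
    as [nu] does not charge [0].  Once such an integral exceeds one, so does
    the energy of every [w] with [|w| < 1 / (n + 1)]. *)
Lemma recip_cauchy_ge_mass : (1 < nu setT)%E ->
  exists2 k, 0 < k & forall z, 0 < Im z -> k <= normc (F z).
Proof.
move=> nu1.
pose k_ (n : nat) (t : mR) : R := t ^+ 2 / (`|t| + n.+1%:R^-1) ^+ 2.
have den n t : 0 < (`|t| + n.+1%:R^-1) ^+ 2 :> R.
  by rewrite exprn_gt0// ltr_wpDl// harmonic_gt0.
have k0 n t : 0 <= k_ n t by rewrite divr_ge0 ?sqr_ge0.
have mk n : measurable_fun (setT : set mR) (k_ n).
  apply: measurable_funM; first exact: measurable_funX.
  apply: measurable_funV_ge0; first by move=> t; exact: ltW.
  by apply: measurable_funX; apply: measurable_funD => //; exact: measurableT_comp.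
have nd t : {homo k_^~ t : n m / (n <= m)%N >-> n <= m}.
  move=> n m nm; rewrite ler_wpM2l ?sqr_ge0// lef_pV2 ?posrE//.
  rewrite lerXn2r ?nnegrE ?addr_ge0 ?(ltW (harmonic_gt0 R _))//.
  by rewrite lerD2l lef_pV2 ?posrE// ler_nat ltnS.
have kcv t : k_ n t @[n --> \oo] --> (\1_(~` [set (0 : R)]) t : R).
  rewrite indicE; have [->|t0] := eqVneq t 0.
    rewrite memNset; last by move=> /=; apply.
    by apply: cvg_near_cst; apply: nearW => n; rewrite /k_ expr0n/= mul0r.
  rewrite mem_set; last by move=> /= /eqP; rewrite (negbTE t0).
  have c0 : `|t| != 0 by rewrite normr_eq0.
  rewrite -[X in _ --> X]/(1 : R).
  have <- : t ^+ 2 * (`|t| * `|t|)^-1 = 1.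
    by rewrite -expr2 real_normK ?num_real// mulfV// sqrf_eq0.
  apply: cvgM; first exact: cvg_cst.
  have th : `|t| + harmonic n @[n --> \oo] --> `|t|.
    by rewrite -[X in _ --> X]addr0; apply: cvgD; [exact: cvg_cst|exact: cvg_harmonic].
  by apply: cvgV; [rewrite mulf_neq0|exact: (cvgM th th)].
have cv : (\int[nu]_t (k_ n t)%:E)%E @[n --> \oo] -->
    (\int[nu]_t (\1_(~` [set (0 : R)]) t)%:E)%E.
  rewrite (_ : (\int[nu]_t (\1_(~` [set (0 : R)]) t)%:E)%E =
      (\int[nu]_t limn (fun n => (k_ n t)%:E))%E).
    apply: cvg_monotone_convergence => //.
    - by move=> n; exact/measurable_EFinP.
    - by move=> n t _; rewrite lee_fin.
    - by move=> t _ n m nm; rewrite lee_fin; exact: nd.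
  apply: eq_integral => t _; apply/esym/cvg_lim; first exact: ereal_hausdorff.
  by apply: cvg_EFin; [exact: nearW|exact: kcv].
rewrite (integral_indic _ measurableT) ?setIT in cv; last by apply: measurableC; exact: measurable_set1.
rewrite [X in _ --> X]nu_setC0 in cv.
have [N _ HN] : \forall n \near \oo, (1 < \int[nu]_t (k_ n t)%:E)%E.
  by apply: (cv [set u | (1 < u)%E]); exact: open_ereal_gt'.
have {}HN := HN N (leqnn N).
exists N.+1%:R^-1; first exact: harmonic_gt0.
move=> z z0; rewrite leNgt; apply/negP => wk.
have w0 := Im_recip_cauchy_gt0 mu z0.
have := JF z0; apply/negP; rewrite -leNgt.
have ie := rint_levy_energy nu_levy w0.
apply: (@le_trans _ _ (Rintegral nu setT (fun t => normc (t%:C * resolvent (F z) t) ^+ 2))); last first.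
  by rewrite /levy_energy lerDr divr_ge0// sqr_ge0.
rewrite -lee_fin /Rintegral fineK; last exact: (integrable_fin_num measurableT ie).
apply: le_trans (ltW HN) _; apply: ge0_le_integral => //.
- by move=> t _; rewrite lee_fin.
- exact/measurable_EFinP.
- exact: measurable_int ie.
- move=> t _; rewrite lee_fin normcM normcV exprMn exprVn normc_real real_normK ?num_real//.
  rewrite ler_wpM2l ?sqr_ge0//.
  have n0 : 0 < normc (F z - t%:C) by rewrite normc_gt0 subr_real_neq0.
  rewrite lef_pV2 ?posrE ?exprn_gt0// lerXn2r ?nnegrE ?normc_ge0//.
  apply: le_trans (normcB _ _) _; rewrite normc_real addrC lerD2l; exact: ltW.
Qed.

End Zeros.

(** * Levy measures of mass at most one *)
Section SmallMass.
Variables (R : realType) (mu : probR R) (eta : R) (nu : measR R).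
Hypothesis nu0 : nu [set 0] = 0%E.
Hypothesis nu_levy : (\int[nu]_t (Num.min 1 (t ^+ 2))%:E < +oo)%E.
Hypothesis triplet : forall z, right_inverse_dom mu z^-1 ->
  free_cumulant mu z = levy_khintchine eta 0 nu z.
Hypothesis nu1 : (nu setT <= 1)%E.
Local Notation C := R[i].
Local Notation mR := (measurableTypeR R).
Local Notation leb := (@lebesgue_measure R).
Implicit Types (z w v h p : C) (t x c d k e : R).
Local Notation G := (cauchy_transform mu).
Local Notation F := (recip_cauchy mu).
Local Notation H := (right_inverse_ext eta 0 nu).
Local Notation J := (levy_energy 0 nu).
Local Notation cutoff t := (\1_(`[-1, 1] : set R) t : R).
Local Notation q := (fine (nu setT)).

Let HFK z (z0 : 0 < Im z) : H (F z) = z := right_inverse_extK (lexx 0) nu_levy triplet z0.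
Let JF z (z0 : 0 < Im z) : J (F z) < 1 :=
  levy_energy_recip_cauchy (lexx 0) nu_levy triplet z0.

Lemma fin_num_mass : nu setT \is a fin_num.
Proof. by rewrite ge0_fin_numE// (le_lt_trans nu1)// ltry. Qed.

Lemma fine_mass_le1 : q <= 1.
Proof. by rewrite -lee_fin fineK// fin_num_mass. Qed.

Lemma rint_mass_cst c : rint nu (fun=> c).
Proof.
apply/integrableP; split; first exact: measurable_cst.
rewrite integral_cst//= lte_mul_pinfty//.
by rewrite (le_lt_trans nu1)// ltry.
Qed.

Lemma Rintegral_mass_cst c : Rintegral nu setT (fun=> c) = c * q.
Proof. by rewrite Rintegral_cst. Qed.

(** The limit of [H] at [0], see [right_inverse_ext_cvg]. *)
Definition atom_site : R := eta - Rintegral nu setT (fun t => t * cutoff t).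

Definition tresolvent_integral w : C := cintegral nu (fun t => t%:C * resolvent w t).

Lemma cint_tresolvent w : 0 < Im w -> cint nu (fun t => t%:C * resolvent w t).
Proof.
move=> w0; apply: (cint_dom (cmeas_tresolvent w0) (rint_mass_cst (kernel_bound w))) => t.
apply: le_trans (normc_tresolvent_le t w0) _.
by rewrite ler_piMr ?kernel_bound_ge0// ge_min lexx.
Qed.

Lemma right_inverse_ext_small w : 0 < Im w ->
  H w = atom_site%:C + w * (1 + tresolvent_integral w).
Proof.
move=> w0; rewrite right_inverse_extE//.
have i1 := cint_tresolvent w0.
have i2 : cint nu (fun t => (t * cutoff t)%:C).
  apply: (cint_dom _ (rint_mass_cst 1)).
    apply: cmeas_real; apply: measurable_funM => //.
  move=> t; rewrite normc_real cutoffE; case: (leP `|t| 1) => ht.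
    by rewrite mulr1.
  by rewrite mulr0 normr0.
have -> : cintegral nu (levy_kernel w) =
    w * tresolvent_integral w - (Rintegral nu setT (fun t => t * cutoff t))%:C.
  rewrite -cintegral_real -cintegralZ// -cintegralB//; last exact: cintZ.
  by congr cintegral; apply/funext => t; rewrite /levy_kernel rmorphM/= mulrA.
by rewrite /atom_site rmorphB/= mul0r; ring.
Qed.

Lemma tresolvent_energy w t : 0 < Im w ->
  normc (t%:C * resolvent w t) <= (1 + normc (t%:C * resolvent w t) ^+ 2) / 2.
Proof.
move=> w0; have := sqr_ge0 (1 - normc (t%:C * resolvent w t)).
by move: (normc _) => u; rewrite sqrrB expr1n mul1r; lra.
Qed.

Lemma Rintegral_energy w : 0 < Im w ->
  rint nu (fun t => (1 + normc (t%:C * resolvent w t) ^+ 2) / 2) /\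
  Rintegral nu setT (fun t => (1 + normc (t%:C * resolvent w t) ^+ 2) / 2) =
    (q + J w) / 2.
Proof.
move=> w0; have i1 := rint_levy_energy nu_levy w0.
have i2 : rint nu (fun t => 1 + normc (t%:C * resolvent w t) ^+ 2).
  by apply: rintD => //; exact: rint_mass_cst.
split; first by under eq_fun do rewrite mulrC; exact: rintZ.
rewrite RintegralZr// RintegralD ?Rintegral_mass_cst//; last exact: rint_mass_cst.
by rewrite /levy_energy mul0r add0r mul1r.
Qed.

(** [|t / (w - t)| <= (1 + |t / (w - t)|^2) / 2], whose integral is
    [(q + J w) / 2 <= 1] at [w = F z]. *)
Lemma recip_cauchy_atom_bound z : 0 < Im z -> normc (z - atom_site%:C) <= 3 * normc (F z).
Proof.
move=> z0; have w0 := Im_recip_cauchy_gt0 mu z0.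
rewrite -{1}(HFK z0) right_inverse_ext_small// addrC addKr normcM mulrC.
rewrite ler_wpM2r ?normc_ge0//; apply: le_trans (normcD _ _) _; rewrite normc1.
have [i1 e1] := Rintegral_energy w0.
have := normc_cintegral (cmeas_tresolvent w0) i1 (fun t => tresolvent_energy t w0).
rewrite e1; have := JF z0; have := fine_mass_le1.
rewrite -/(tresolvent_integral (F z)).
by move: q (J _) (normc _) => u v w; lra.
Qed.

Lemma right_inverse_ext_cvg :
  (H (0 +i* y) : C^o) @[y --> 0^'+] --> (atom_site%:C : C^o).
Proof.
apply/cvgrPdist_lt => e e0.
have [ee ep] : e = (Re e)%:C /\ 0 < Re e.
  by move: e0; rewrite ltcE /= => /andP[/eqP ei er]; split=> //; apply: complexP.
near=> y.
have y0 : 0 < y by near: y; exact: nbhs_right_gt.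
have w0 : 0 < Im (0 +i* y : C) by [].
rewrite right_inverse_ext_small// opprD addrA subrr add0r normrN ee.
rewrite (_ : `|_| = (normc ((0 +i* y) * (1 + tresolvent_integral (0 +i* y))))%:C)//.
rewrite ltcR normcM (_ : normc (0 +i* y) = y); last first.
  by rewrite /= expr0n/= add0r sqrtr_sqr gtr0_norm.
have h : normc (tresolvent_integral (0 +i* y)) <= 2.
  apply: le_trans (normc_cintegral (cmeas_tresolvent w0) (rint_mass_cst 1) _) _.
    move=> t; rewrite normcM normcV normc_real ler_pdivrMr ?normc_gt0 ?subr_real_neq0// mul1r.
    by apply: le_trans (Re_le_normc _); rewrite cReB /= sub0r normrN.
  rewrite Rintegral_mass_cst mul1r; have := fine_mass_le1; lra.
apply: (@le_lt_trans _ _ (y * 3)).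
  rewrite ler_pM2l//; apply: le_trans (normcD _ _) _; rewrite normc1; lra.
rewrite -ltr_pdivlMr//; near: y; apply: nbhs_right_lt; by rewrite divr_gt0.
Unshelve. all: by end_near. Qed.

(** The real part of [i y / w = 1 + int t / (w - t) dnu] at
    [w = F (x0 + i y)]. *)
Lemma cauchy_transform_atom_site y : 0 < y ->
  y * - Im (G (atom_site +i* y)) =
  1 + Rintegral nu setT (fun t => Re (t%:C * resolvent (F (atom_site +i* y)) t)).
Proof.
move=> y0; set z := atom_site +i* y; have z0 : 0 < Im z by [].
have w0 := Im_recip_cauchy_gt0 mu z0.
rewrite -[RHS]/(Re (1 + tresolvent_integral (F z))).
have e : (0 +i* y) * G z = 1 + tresolvent_integral (F z).
  have -> : 0 +i* y = F z * (1 + tresolvent_integral (F z)).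
    have := right_inverse_ext_small w0; rewrite HFK// => e.
    rewrite (_ : F z * _ = z - atom_site%:C); last first.
      by apply/esym/eqP; rewrite subr_eq addrC; apply/eqP.
    by apply: complexP; rewrite /z /= ?subrr ?subr0.
  by rewrite cauchy_transformV mulrAC mulfV ?mul1r// Im_gt0_neq0.
by rewrite -e cReM /= mul0r add0r mulrN.
Qed.

(** If there is an atom of mass [m], then [y Im w / |w|^2 >= m / 2] for small
    [y]; together with [y <= Im w] this gives [|w| <= (2 / m) Im w] and
    [|w| <= (2 / m) y].  So [w] tends to [0] non-tangentially, [t / (w - t)] is
    dominated by a constant, and it tends to [-1] for [t != 0]. *)
Lemma atom_mass : 0 < fine (mu [set atom_site]) -> fine (mu [set atom_site]) = 1 - q.
Proof.
set m := fine _ => m0; have cm := @cvg_atom _ mu atom_site.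
have [N _ HN] : \forall n \near \oo,
    m / 2 <= n.+1%:R^-1 * - Im (G (atom_site +i* n.+1%:R^-1)).
  by apply: (cvgr_ge _ cm); rewrite -/m; lra.
(* the shift by [N] makes the domination hold along the whole sequence *)
pose y n : R := (n + N).+1%:R^-1.
pose w n := F (atom_site +i* y n).
have y0 n : 0 < y n by exact: harmonic_gt0.
have w0 n : 0 < Im (w n) by apply: Im_recip_cauchy_gt0; exact: y0.
have yw n : y n <= Im (w n).
  exact: (Im_le_recip_cauchy (lexx 0) nu_levy triplet (z := atom_site +i* y n) (y0 n)).
have nw n : 0 < normc (w n) by rewrite normc_gt0 Im_gt0_neq0.
have wy n : normc (w n) <= 2 / m * y n.
  have := HN (n + N)%N (leq_addl _ _); rewrite -/(y n) cauchy_transformV -/(w n).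
  rewrite cImV -sqr_normcE mulNr opprK mulrA ler_pdivlMr ?exprn_gt0//.
  have := Im_le_normc (w n); rewrite (gtr0_norm (w0 n)) => h1 h2.
  have h3 : m / 2 * normc (w n) ^+ 2 <= y n * normc (w n).
    by apply: le_trans h2 _; rewrite ler_pM2l.
  rewrite expr2 mulrA ler_pM2r// in h3.
  by rewrite mulrAC ler_pdivlMr//; move: h3; lra.
pose K := 2 / m.
have K0 : 0 < K by rewrite divr_gt0.
have K10 : 0 < K + 1 by rewrite ltr_wpDl// ltW.
have KK0 : 0 < K * (K + 1) by exact: mulr_gt0.
have wI n : normc (w n) <= K * Im (w n).
  by apply: le_trans (wy n) _; rewrite ler_pM2l.
have tw n t : `|t| <= (K + 1) * normc (w n - t%:C).
  have h1 := Im_le_normc_sub (w n) t.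
  have h2 := wI n; have h3 : K * Im (w n) <= K * normc (w n - t%:C) by rewrite ler_pM2l.
  have := normcB (w n) (w n - t%:C); rewrite subKr normc_real; lra.
have nwt n t : 0 < normc (w n - t%:C) by rewrite normc_gt0 subr_real_neq0.
have lim1 : 1 + Rintegral nu setT (fun t => Re (t%:C * resolvent (w n) t)) @[n --> \oo] --> m.
  rewrite (_ : (fun n => _) = fun n =>
      (fun n => n.+1%:R^-1 * - Im (G (atom_site +i* n.+1%:R^-1))) (n + N)%N).
    by have cmN := cm; rewrite -(cvg_shiftn N) in cmN; exact: cmN.
  by apply/funext => n; rewrite cauchy_transform_atom_site// harmonic_gt0.
have lim2 : 1 + Rintegral nu setT (fun t => Re (t%:C * resolvent (w n) t)) @[n --> \oo] -->
    1 + Rintegral nu setT (fun t => - \1_(~` [set (0 : R)]) t).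
  apply: cvgD; first exact: cvg_cst.
  apply: (@Rintegral_dominated_cvg _ _ _ _ (fun=> K + 1)).
  - by move=> n; have [] := cmeas_tresolvent (w0 n).
  - exact: rint_mass_cst.
  - move=> n t; apply: le_trans (Re_le_normc _) _.
    by rewrite normcM normcV normc_real ler_pdivrMr.
  - move=> t; rewrite indicE; have [->|t0] := eqVneq t 0.
      rewrite memNset; last by move=> /=; apply.
      by apply: cvg_near_cst; apply: nearW => n; rewrite mul0r oppr0.
    rewrite mem_set; last by move=> /= /eqP; rewrite (negbTE t0).
    have at0 : 0 < `|t| by rewrite normr_gt0.
    apply/cvgrPdist_le => e e0.
    have [M _ HM] : \forall n \near \oo, `|0 - harmonic n| <= e * `|t| / (K * (K + 1)) :> R.
      apply: cvgr_dist_le; first exact: cvg_harmonic.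
      by apply: divr_gt0 => //; exact: mulr_gt0.
    exists M => // n /= Mn.
    have {HM} := HM (n + N)%N (leq_trans Mn (leq_addr _ _)).
    rewrite /harmonic /= sub0r normrN gtr0_norm// -/(y n) => yn.
    rewrite -opprD normrN (_ : true%:R = 1 :> R)//.
    have -> : 1 + Re (t%:C * resolvent (w n) t) = Re (w n * resolvent (w n) t).
      rewrite (_ : w n * _ = 1 + t%:C * resolvent (w n) t) ?cReD//.
      by rewrite /resolvent; field; rewrite subr_real_neq0.
    apply: le_trans (Re_le_normc _) _; rewrite normcM (normcV (w n - t%:C)) ler_pdivrMr//.
    apply: le_trans (wy n) _; rewrite -/K.
    rewrite ler_pdivlMr// in yn.
    have h1 : e * `|t| <= e * ((K + 1) * normc (w n - t%:C)) by rewrite ler_pM2l.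
    rewrite -(@ler_pM2r _ (K + 1))//.
    by move: yn h1; move: (normc _) `|t| (y n) => u v s; lra.
have := cvg_unique _ lim1 lim2 => -> //.
rewrite (_ : (fun t => - \1_(~` [set (0 : R)]) t) = fun t => -1 * \1_(~` [set (0 : R)]) t); last first.
  by apply/funext => t; rewrite mulN1r.
have mC : measurable (~` [set (0 : R)] : set mR) by apply: measurableC; exact: measurable_set1.
rewrite RintegralZl//; last first.
  apply: (rint_le _ (rint_mass_cst 1)); first exact: measurable_indic.
  by move=> t; rewrite indicE; case: (_ \in _); rewrite ?normr1 ?normr0.
rewrite mulN1r; congr (_ - _); rewrite /Rintegral (integral_indic _ measurableT)// setIT.
by rewrite (nu_setC0 nu0).
Qed.

(** The real part of [1 + int t / (w - t) dnu] is at least [1 - (q + J w) / 2],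
    and [J w < 1]. *)
Lemma atom_mass_ge : (1 - q) / 2 <= fine (mu [set atom_site]).
Proof.
have cm := @cvg_atom _ mu atom_site.
apply: (cvgr_to_ge cm); apply: nearW => n.
have z0 : 0 < Im (atom_site +i* n.+1%:R^-1) by exact: harmonic_gt0.
rewrite (cauchy_transform_atom_site (harmonic_gt0 R n)).
set z := _ +i* _ in z0 *; have w0 := Im_recip_cauchy_gt0 mu z0.
have [i1 e1] := Rintegral_energy w0.
have [i2 _] := cint_tresolvent w0.
have h : - Rintegral nu setT (fun t => Re (t%:C * resolvent (F z) t)) <= (q + J (F z)) / 2.
  rewrite -e1 -mulN1r -RintegralZl//; apply: le_Rintegral => //; first exact: rintZ.
  move=> t _; rewrite mulN1r; apply: le_trans (tresolvent_energy t w0).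
  by apply: le_trans (Re_le_normc _); rewrite -normrN ler_norm.
have := JF z0; move: h; move: (Rintegral _ _ _) (J _) q => u v r; lra.
Qed.

(** Off [x0] the measure has a density on intervals that exhaust the two half
    lines, and [x0] is not an atom: its mass would be [1 - q = 0]. *)
Lemma null_of_mass_one : nu setT = 1%E -> mu `<< leb.
Proof.
move=> nuT; have q1 : q = 1 by rewrite nuT.
have atom0 : mu [set atom_site] = 0%E.
  have f0 : fine (mu [set atom_site]) = 0.
    apply/eqP; rewrite eq_le fine_ge0// andbT leNgt; apply/negP => m0.
    by have := atom_mass m0; rewrite q1 subrr => h; rewrite h ltxx in m0.
  by rewrite -[LHS]fineK ?f0// fin_num_measure//; exact: measurable_set1.
have nondeg : 0 < 0 :> R \/ nu setT != 0%E by right; rewrite nuT onee_neq0.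
have good c d e : 0 < e -> (forall x, c <= x <= d -> e <= `|x - atom_site|) ->
    away_from_zero mu c d (e / 3).
  move=> e0 cde; split; first by rewrite divr_gt0.
  move=> z zcd /andP[z0 _]; rewrite ler_pdivrMr// mulrC.
  apply: le_trans (recip_cauchy_atom_bound z0); apply: le_trans (cde _ zcd) _.
  by apply: le_trans (Re_le_normc _); rewrite cReB.
apply/null_content_dominatesP => A mA A0.
pose Ar n : set mR := A `&` `]atom_site + n.+1%:R^-1, atom_site + n.+2%:R]%classic.
pose Al n : set mR := A `&` `]atom_site - n.+2%:R, atom_site - n.+1%:R^-1]%classic.
have n2 n : 1 < n.+2%:R :> R by rewrite ltr1n.
have negr n : mu.-negligible (Ar n).
  apply/negligibleP; first by apply: measurableI => //; exact: measurable_itv.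
  have h1 := harmonic_gt0 R n; have h2 := harmonic_le1 R n; have h3 := n2 n.
  apply: (null_where_away_from_zero (lexx 0) nu0 nu_levy triplet nondeg _
    (good _ _ _ h1 _) mA A0); first by rewrite ltrD2l (le_lt_trans h2).
  by move=> x /andP[x1 _]; apply: le_trans (ler_norm _); rewrite lerBrDl.
have negl n : mu.-negligible (Al n).
  apply/negligibleP; first by apply: measurableI => //; exact: measurable_itv.
  have h1 := harmonic_gt0 R n; have h2 := harmonic_le1 R n; have h3 := n2 n.
  apply: (null_where_away_from_zero (lexx 0) nu0 nu_levy triplet nondeg _
    (good _ _ _ h1 _) mA A0); first by rewrite ltrD2l ltrN2 (le_lt_trans h2).
  move=> x /andP[_ x1]; rewrite distrC; apply: le_trans (ler_norm _).
  by rewrite lerBrDl -lerBrDr.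
have ne0 : mu.-negligible [set atom_site].
  by apply/negligibleP; [exact: measurable_set1|exact: atom0].
apply: measure_negligible => //.
apply: negligibleS (negligibleU ne0 (negligibleU
  (negligible_bigcup negr) (negligible_bigcup negl))) => x Ax.
have [xa|xa] := eqVneq x atom_site; [by left|right].
pose r := `|x - atom_site|; have r0 : 0 < r by rewrite normr_gt0 subr_eq0.
pose n := maxn (Num.truncn r) (Num.truncn r^-1).
have rn : r < n.+1%:R.
  apply: lt_le_trans (real_truncnS_gt (num_real r)) _.
  by rewrite ler_nat ltnS leq_maxl.
have rn' : n.+1%:R^-1 < r.
  rewrite -[r]invrK ltf_pV2 ?posrE ?invr_gt0//.
  apply: lt_le_trans (real_truncnS_gt (num_real _)) _.
  by rewrite ler_nat ltnS leq_maxr.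
have rn2 : r < n.+2%:R by apply: lt_trans rn _; rewrite ltr_nat.
move: rn' rn2; rewrite /r; case: (ltgtP x atom_site) xa => // xs _.
  rewrite ltr0_norm ?subr_lt0// => h1 h2; right; exists n => //; split => //=.
  by rewrite in_itv/=; apply/andP; split; move: h1 h2; move: (n.+1%:R^-1) (n.+2%:R) => u v; lra.
rewrite gtr0_norm ?subr_gt0// => h1 h2; left; exists n => //; split => //=.
by rewrite in_itv/=; apply/andP; split; move: h1 h2; move: (n.+1%:R^-1) (n.+2%:R) => u v; lra.
Qed.

End SmallMass.

(** * Absolute continuity and atoms *)

Theorem theorem3p4 (R : realType) (mu : probR R) (eta a : R) (nu : measR R)
    (FIDmu : freely_inf_div mu) (triplet : free_char_triplet mu eta a nu) :
  [/\ (0 < a \/ (a = 0 /\ (1 < nu setT)%E)) ->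
        mu `<< lebesgue_measure /\
        exists f : R -> R, continuous f /\ is_density mu f,
      a = 0 -> nu setT = 1%E ->
        mu `<< lebesgue_measure &
      a = 0 -> (nu setT < 1)%E ->
        exists x : R,
          (right_inverse_ext eta a nu (0 +i* y) : R[i]^o) @[y --> 0^'+]
            --> (x%:C : R[i]^o)
          /\ mu [set x] = (1 - nu setT)%E].
Proof.
have [a0 nu0 nu_levy LK] := triplet.
split.
- move=> h.
  have [k k0 Fk] : exists2 k, 0 < k &
      forall z, 0 < Im z -> k <= normc (recip_cauchy mu z).
    case: h => [ap|[_ nu1]].
      exists (Num.sqrt a); first by rewrite sqrtr_gt0.
      by move=> z; exact: (recip_cauchy_ge_gaussian a0 nu_levy LK).
    exact: (recip_cauchy_ge_mass a0 nu0 nu_levy LK nu1).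
  apply: (continuous_density a0 nu0 nu_levy LK (k := k)).
    by case: h => [|[_ nu1]]; [left|right; rewrite gt_eqF// (lt_trans _ nu1)].
  by move=> c d; split=> // z _ /andP[z0 _]; exact: Fk.
- move=> ae nuT; subst a.
  by apply: (null_of_mass_one nu0 nu_levy LK) => //; rewrite nuT.
- move=> ae nuT; subst a; have nuT1 := ltW nuT.
  exists (atom_site eta nu); split; first exact: right_inverse_ext_cvg.
  have ffin := fin_num_mass nuT1.
  have q1 : fine (nu setT) < 1 by rewrite -lte_fin fineK.
  have m0 : 0 < fine (mu [set atom_site eta nu]).
    apply: lt_le_trans (atom_mass_ge nu_levy LK nuT1).
    by rewrite divr_gt0// subr_gt0.
  have fm : mu [set atom_site eta nu] \is a fin_num.
    by apply: fin_num_measure; exact: measurable_set1.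
  rewrite -(fineK fm) (atom_mass nu0 nu_levy LK nuT1 m0) EFinB.
  by congr (_ - _)%E; rewrite fineK.
Qed.
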